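(* Let $e\ge1$ and $n\ge2$, with the case ($n=2$ and $e$ even) excluded. The set $\Lambda=\Lambda_2\Lambda_3\cdots\Lambda_n$ is an $R_0$-basis of the Hecke algebra $H(e,e,n)$.
   Context: Let $R_0=\mathbb{Z}[a]$ (polynomial ring). $H(e,e,n)$ is the unitary associative $R_0$-algebra generated by $t_i$ ($i\in\mathbb{Z}/e\mathbb{Z}$) and $s_3,\dots,s_n$ with relations: (1) $t_it_{i-1}=t_jt_{j-1}$ for $i,j\in\mathbb{Z}/e\mathbb{Z}$; (2) $t_is_3t_i=s_3t_is_3$ for $i\in\mathbb{Z}/e\mathbb{Z}$; (3) $s_jt_i=t_is_j$ for $i\in\mathbb{Z}/e\mathbb{Z}$, $4\le j\le n$; (4) $s_is_{i+1}s_i=s_{i+1}s_is_{i+1}$ for $3\le i\le n-1$; (5) $s_is_j=s_js_i$ for $|i-j|>1$; (6) $t_i^2-at_i-1=0$ for $i\in\mathbb{Z}/e\mathbb{Z}$ and $s_j^2-as_j-1=0$ for $3\le j\le n$. Put $s_2:=t_0$. Define the subsets of $H(e,e,n)$: $\Lambda_2=\{1\}\cup\{t_k: 0\le k\le e-1\}\cup\{t_kt_0: 1\le k\le e-1\}$, and for $3\le i\le n$, $\Lambda_i=\{1\}\cup\{s_i\cdots s_{i'}: 3\le i'\le i\}\cup\{s_i\cdots s_3t_k: 0\le k\le e-1\}\cup\{s_i\cdots s_3t_ks_2\cdots s_{i'}: 1\le k\le e-1,\ 2\le i'\le i\}$, where $s_i\cdots s_{i'}$ and $s_i\cdots s_3$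 have decreasing consecutive indices and $s_2\cdots s_{i'}$ has increasing consecutive indices. $\Lambda=\Lambda_2\cdots\Lambda_n$ is the set (family) of products $a_2a_3\cdots a_n$ with $a_i\in\Lambda_i$ for $2\le i\le n$. *)

(* Defs.v *)
From HB Require Import structures.
From mathcomp Require Import all_boot all_order all_algebra.
From mathcomp Require Import generic_quotient ring boolp.

Set Implicit Arguments.
Unset Strict Implicit.
Unset Printing Implicit Defensive.

Import GRing.Theory.
Local Open Scope ring_scope.
Local Open Scope quotient_scope.

(* Unitary associative R-algebras given by generators X and relations rel:    *)
(* formal expressions modulo the least congruence that contains rel and the   *)
(* algebra axioms. Such an algebra may be trivial, so in general it only has  *)
(* pzRingType and lmodType instances. Its universal property is given by      *)
(* pres_lift, pres_lift_var and pres_lift_unique.                             *)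

Inductive expr (R X : Type) : Type :=
  | EVar of X
  | EZero
  | EOne
  | EOpp of expr R X
  | EAdd of expr R X & expr R X
  | EMul of expr R X & expr R X
  | EScale of R & expr R X.

Arguments EVar {R X} _.
Arguments EZero {R X}.
Arguments EOne {R X}.

Declare Scope expr_scope.
Delimit Scope expr_scope with expr.
Bind Scope expr_scope with expr.
Notation "0" := EZero : expr_scope.
Notation "1" := EOne : expr_scope.
Notation "- u" := (EOpp u) : expr_scope.
Notation "u + v" := (EAdd u v) : expr_scope.
Notation "u - v" := (EAdd u (EOpp v)) : expr_scope.
Notation "u * v" := (EMul u v) : expr_scope.
Notation "c *: u" := (EScale c%R u) : expr_scope.

HB.instance Definition _ (R X : Type) := gen_eqMixin (expr R X).
HB.instance Definition _ (R X : Type) := gen_choiceMixin (expr R X).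

Section Presentation.

Variables (R : comNzRingType) (X : Type) (rel : expr R X -> expr R X -> Prop).

Inductive prescong : expr R X -> expr R X -> Prop :=
  | pc_rel u v : rel u v -> prescong u v
  | pc_refl u : prescong u u
  | pc_sym u v : prescong u v -> prescong v u
  | pc_trans v u w : prescong u v -> prescong v w -> prescong u w
  | pc_opp u u' : prescong u u' -> prescong (- u) (- u')
  | pc_add u u' v v' :
      prescong u u' -> prescong v v' -> prescong (u + v) (u' + v')
  | pc_mul u u' v v' :
      prescong u u' -> prescong v v' -> prescong (u * v) (u' * v')
  | pc_scale c u u' : prescong u u' -> prescong (c *: u) (c *: u')
  | pc_addA u v w : prescong (u + (v + w)) (u + v + w)
  | pc_addC u v : prescong (u + v) (v + u)
  | pc_add0 u : prescong (0 + u) u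
  | pc_addN u : prescong (- u + u) 0
  | pc_mulA u v w : prescong (u * (v * w)) (u * v * w)
  | pc_mul1l u : prescong (1 * u) u
  | pc_mul1r u : prescong (u * 1) u
  | pc_mulDl u v w : prescong ((u + v) * w) (u * w + v * w)
  | pc_mulDr u v w : prescong (u * (v + w)) (u * v + u * w)
  | pc_scaleA c d u : prescong (c *: (d *: u)) ((c * d) *: u)
  | pc_scale1 u : prescong (1 *: u) u
  | pc_scaleDr c u v : prescong (c *: (u + v)) (c *: u + c *: v)
  | pc_scaleDl u c d : prescong ((c + d) *: u) (c *: u + d *: u)
  | pc_scaleAl c u v : prescong (c *: (u * v)) ((c *: u) * v)
  | pc_scaleAr c u v : prescong (c *: (u * v)) (u * (c *: v)).

Definition prescongb (u v : expr R X) : bool := `[< prescong u v >].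

Lemma prescongb_equiv : equiv_class_of prescongb.
Proof.
split=> [u|u v|v u w]; first by apply/asboolP; apply: pc_refl.
- by apply/asboolP/asboolP; apply: pc_sym.
- by move=> /asboolP uv /asboolP vw; apply/asboolP; apply: pc_trans uv vw.
Qed.

Canonical prescongb_equivRel := EquivRelPack prescongb_equiv.

Definition presalg : Type := {eq_quot prescongb}.
HB.instance Definition _ := Choice.on presalg.
HB.instance Definition _ := Quotient.on presalg.

Definition presclass (u : expr R X) : presalg := \pi_presalg u.

Lemma presclassP u v : presclass u = presclass v <-> prescong u v.
Proof.
split=> [/(@eqquotP _ _ presalg)/asboolP // | uv].
by apply/(@eqquotP _ _ presalg)/asboolP.
Qed.

Lemma presrepr u : prescong (repr (presclass u)) u.
Proof. by apply/presclassP; rewrite /presclass reprK. Qed.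

Lemma presclass_surj (x : presalg) : {u | x = presclass u}.
Proof. by exists (repr x); rewrite /presclass reprK. Qed.

Definition pres_zero : presalg := presclass 0.
Definition pres_one : presalg := presclass 1.
Definition pres_opp (x : presalg) : presalg := presclass (- repr x).
Definition pres_add (x y : presalg) : presalg := presclass (repr x + repr y).
Definition pres_mul (x y : presalg) : presalg := presclass (repr x * repr y).
Definition pres_scale (c : R) (x : presalg) : presalg :=
  presclass (c *: repr x).

Fact pres_oppE u : pres_opp (presclass u) = presclass (- u).
Proof. by apply/presclassP/pc_opp/presrepr. Qed.
Fact pres_addE u v : pres_add (presclass u) (presclass v) = presclass (u + v).
Proof. by apply/presclassP/pc_add; apply: presrepr. Qed.
Fact pres_mulE u v : pres_mul (presclass u) (presclass v) = presclass (u * v).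
Proof. by apply/presclassP/pc_mul; apply: presrepr. Qed.
Fact pres_scaleE c u : pres_scale c (presclass u) = presclass (c *: u).
Proof. by apply/presclassP/pc_scale/presrepr. Qed.

Let presE := (pres_oppE, pres_addE, pres_mulE, pres_scaleE).

Fact pres_addA : associative pres_add.
Proof.
move=> x y z; have [[[u ->] [v ->]] [w ->]] :=
  (presclass_surj x, presclass_surj y, presclass_surj z).
by rewrite !presE; apply/presclassP/pc_addA.
Qed.
Fact pres_addC : commutative pres_add.
Proof.
move=> x y; have [[u ->] [v ->]] := (presclass_surj x, presclass_surj y).
by rewrite !presE; apply/presclassP/pc_addC.
Qed.
Fact pres_add0 : left_id pres_zero pres_add.
Proof.
move=> x; have [u ->] := presclass_surj x.
by rewrite !presE; apply/presclassP/pc_add0.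
Qed.
Fact pres_addN : left_inverse pres_zero pres_opp pres_add.
Proof.
move=> x; have [u ->] := presclass_surj x.
by rewrite !presE; apply/presclassP/pc_addN.
Qed.
HB.instance Definition _ := GRing.isZmodule.Build presalg
  pres_addA pres_addC pres_add0 pres_addN.

Fact pres_mulA : associative pres_mul.
Proof.
move=> x y z; have [[[u ->] [v ->]] [w ->]] :=
  (presclass_surj x, presclass_surj y, presclass_surj z).
by rewrite !presE; apply/presclassP/pc_mulA.
Qed.
Fact pres_mul1l : left_id pres_one pres_mul.
Proof.
move=> x; have [u ->] := presclass_surj x.
by rewrite !presE; apply/presclassP/pc_mul1l.
Qed.
Fact pres_mul1r : right_id pres_one pres_mul.
Proof.
move=> x; have [u ->] := presclass_surj x.
by rewrite !presE; apply/presclassP/pc_mul1r.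
Qed.
Fact pres_mulDl : left_distributive pres_mul +%R.
Proof.
move=> x y z; have [[[u ->] [v ->]] [w ->]] :=
  (presclass_surj x, presclass_surj y, presclass_surj z).
by rewrite /+%R /= !presE; apply/presclassP/pc_mulDl.
Qed.
Fact pres_mulDr : right_distributive pres_mul +%R.
Proof.
move=> x y z; have [[[u ->] [v ->]] [w ->]] :=
  (presclass_surj x, presclass_surj y, presclass_surj z).
by rewrite /+%R /= !presE; apply/presclassP/pc_mulDr.
Qed.
HB.instance Definition _ := GRing.Zmodule_isPzRing.Build presalg
  pres_mulA pres_mul1l pres_mul1r pres_mulDl pres_mulDr.

Fact pres_scaleA c d x :
  pres_scale c (pres_scale d x) = pres_scale (c * d) x.
Proof.
have [u ->] := presclass_surj x.
by rewrite !presE; apply/presclassP/pc_scaleA.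
Qed.
Fact pres_scale1 : left_id 1 pres_scale.
Proof.
move=> x; have [u ->] := presclass_surj x.
by rewrite !presE; apply/presclassP/pc_scale1.
Qed.
Fact pres_scaleDr : right_distributive pres_scale +%R.
Proof.
move=> c x y; have [[u ->] [v ->]] := (presclass_surj x, presclass_surj y).
by rewrite /+%R /= !presE; apply/presclassP/pc_scaleDr.
Qed.
Fact pres_scaleDl x : {morph pres_scale^~ x : c d / c + d}.
Proof.
move=> c d; have [u ->] := presclass_surj x.
by rewrite {2}/+%R /= !presE; apply/presclassP/pc_scaleDl.
Qed.
HB.instance Definition _ := GRing.Zmodule_isLmodule.Build R presalg
  pres_scaleA pres_scale1 pres_scaleDr pres_scaleDl.

Lemma presclass0 : presclass 0 = 0. Proof. by []. Qed.
Lemma presclass1 : presclass 1 = 1. Proof. by []. Qed.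
Lemma presclassN u : presclass (- u) = - presclass u.
Proof. by rewrite -pres_oppE. Qed.
Lemma presclassD u v : presclass (u + v) = presclass u + presclass v.
Proof. by rewrite -pres_addE. Qed.
Lemma presclassM u v : presclass (u * v) = presclass u * presclass v.
Proof. by rewrite -pres_mulE. Qed.
Lemma presclassZ c u : presclass (c *: u) = c *: presclass u.
Proof. by rewrite -pres_scaleE. Qed.

Lemma pres_scaleAl (c : R) (x y : presalg) : c *: (x * y) = (c *: x) * y.
Proof.
have [[u ->] [v ->]] := (presclass_surj x, presclass_surj y).
by rewrite -!(presclassM, presclassZ); apply/presclassP/pc_scaleAl.
Qed.
Lemma pres_scaleAr (c : R) (x y : presalg) : c *: (x * y) = x * (c *: y).
Proof.
have [[u ->] [v ->]] := (presclass_surj x, presclass_surj y).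
by rewrite -!(presclassM, presclassZ); apply/presclassP/pc_scaleAr.
Qed.

End Presentation.

Section Universal.

Variables (R : comNzRingType) (X : Type) (rel : expr R X -> expr R X -> Prop).
Variables (A : algType R) (f : X -> A).

Fixpoint expr_eval (u : expr R X) : A :=
  match u with
  | EVar x => f x
  | EZero => 0
  | EOne => 1
  | EOpp u => - expr_eval u
  | EAdd u v => expr_eval u + expr_eval v
  | EMul u v => expr_eval u * expr_eval v
  | EScale c u => c *: expr_eval u
  end.

Hypothesis frel : forall u v, rel u v -> expr_eval u = expr_eval v.

Lemma expr_eval_cong u v : prescong rel u v -> expr_eval u = expr_eval v.
Proof.
elim=> {u v} //=; try congruence; move=> *;
  by [apply: frel | rewrite addrA | rewrite addrC | rewrite add0r
     | rewrite addNr | rewrite mulrA | rewrite mul1r | rewrite mulr1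
     | rewrite mulrDl | rewrite mulrDr | rewrite scalerA | rewrite scale1r
     | rewrite scalerDr | rewrite scalerDl | rewrite scalerAl
     | rewrite scalerAr].
Qed.

Definition pres_lift (x : presalg rel) : A := expr_eval (repr x).

Lemma pres_liftE u : pres_lift (presclass rel u) = expr_eval u.
Proof. exact/expr_eval_cong/presrepr. Qed.

Fact pres_lift_linear : linear pres_lift.
Proof.
move=> c x y; have [[u ->] [v ->]] := (presclass_surj x, presclass_surj y).
by rewrite -presclassZ -presclassD !pres_liftE.
Qed.
HB.instance Definition _ :=
  GRing.isLinear.Build R (presalg rel) A *:%R pres_lift pres_lift_linear.

Fact pres_lift_monoid : monoid_morphism pres_lift.
Proof.
split=> [|x y]; first by rewrite -presclass1 pres_liftE.
have [[u ->] [v ->]] := (presclass_surj x, presclass_surj y).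
by rewrite -presclassM !pres_liftE.
Qed.
HB.instance Definition _ :=
  GRing.isMonoidMorphism.Build (presalg rel) A pres_lift pres_lift_monoid.

Lemma pres_lift_var x : pres_lift (presclass rel (EVar x)) = f x.
Proof. exact: pres_liftE. Qed.

Lemma pres_lift_unique (g : presalg rel -> A) :
    linear g -> monoid_morphism g ->
    (forall x, g (presclass rel (EVar x)) = f x) -> g =1 pres_lift.
Proof.
move=> gL [g1 gM] gX y; have [u ->] := presclass_surj y; rewrite pres_liftE.
have gD v w : g (v + w) = g v + g w by have := gL 1 v w; rewrite !scale1r.
have g0 : g 0 = 0 by apply: (addrI (g 0)); rewrite -gD !addr0.
elim: u => //= [u IH|u IHu v IHv|u IHu v IHv|c u IH].
- rewrite presclassN -IH; apply: (addrI (g (presclass rel u))).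
  by rewrite -gD !subrr.
- by rewrite presclassD gD IHu IHv.
- by rewrite presclassM gM IHu IHv.
- by rewrite presclassZ -[_ *: _]addr0 gL g0 addr0 IH.
Qed.

End Universal.

(* The basis is a family, given as a list: its entries are counted with       *)
(* multiplicity.                                                              *)
Definition is_basis (R : pzRingType) (V : lmodType R) (b : seq V) : Prop :=
  (forall c : 'I_(size b) -> R,
     \sum_(i < size b) c i *: b`_i = 0 -> forall i, c i = 0)
  /\ (forall v : V, exists c : 'I_(size b) -> R,
        v = \sum_(i < size b) c i *: b`_i).

(* 'I_e stands for Z/eZ, with i - 1 given by the cyclic predecessor ord_pred  *)
(* (the notation 'Z_e would be wrong for e = 1).                              *)
Definition sidx (n : nat) : Type := {j : nat | (3 <= j <= n)%N}.

Inductive hgen (e n : nat) : Type :=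
  | GT of 'I_e
  | GS of sidx n.

Section HeckeRelations.

Variables e n : nat.

Local Notation hexpr := (expr {poly int} (hgen e n)).
Local Notation T i := (EVar (GT n i) : hexpr).
Local Notation S j := (EVar (GS e j) : hexpr).

(* The coefficient ring Z[a] is {poly int}, with a := 'X.                     *)
Inductive hecke_rel : hexpr -> hexpr -> Prop :=
  | hr_tt (i j : 'I_e) :
      hecke_rel (T i * T (ord_pred i)) (T j * T (ord_pred j))
  | hr_t_s3 (i : 'I_e) (j : sidx n) : val j = 3 ->
      hecke_rel (T i * S j * T i) (S j * T i * S j)
  | hr_s_t (i : 'I_e) (j : sidx n) : (4 <= val j)%N ->
      hecke_rel (S j * T i) (T i * S j)
  | hr_braid (i j : sidx n) : val j = (val i).+1 ->
      hecke_rel (S i * S j * S i) (S j * S i * S j)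
  | hr_comm (i j : sidx n) : (val i + 1 < val j)%N || (val j + 1 < val i)%N ->
      hecke_rel (S i * S j) (S j * S i)
  | hr_quad_t (i : 'I_e) :
      hecke_rel (T i * T i - 'X *: T i - 1) 0
  | hr_quad_s (j : sidx n) :
      hecke_rel (S j * S j - 'X *: S j - 1) 0.

Definition hecke : Type := presalg hecke_rel.

HB.instance Definition _ := GRing.PzRing.on hecke.
HB.instance Definition _ := GRing.Lmodule.on hecke.

(* The specialization a := 0, t_i := 1, s_j := 1 shows that 1 != 0 in hecke.  *)
Fixpoint hecke_aug (u : hexpr) : int :=
  match u with
  | EVar _ => 1
  | EZero => 0
  | EOne => 1
  | EOpp u => - hecke_aug u
  | EAdd u v => hecke_aug u + hecke_aug v
  | EMul u v => hecke_aug u * hecke_aug v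
  | EScale c u => c.[0] * hecke_aug u
  end.

Fact hecke_aug_cong u v : prescong hecke_rel u v -> hecke_aug u = hecke_aug v.
Proof.
elim=> {u v} //=; try congruence.
- move=> u v; case=> //= *; rewrite hornerX; ring.
all: by move=> *; rewrite ?(hornerM, hornerD, hornerC); ring.
Qed.

Fact hecke_oner_neq0 : (1 : hecke) != 0.
Proof. by apply/eqP => /presclassP /hecke_aug_cong. Qed.
HB.instance Definition _ :=
  GRing.PzSemiRing_isNonZero.Build hecke hecke_oner_neq0.
HB.instance Definition _ :=
  GRing.Lmodule_isLalgebra.Build {poly int} hecke (@pres_scaleAl _ _ _).
HB.instance Definition _ :=
  GRing.Lalgebra_isAlgebra.Build {poly int} hecke (@pres_scaleAr _ _ _).

(* The generators, indexed by natural numbers; the value 1 outside the ranges *)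
(* k < e and 3 <= j <= n is a dummy that is never used below when 1 <= e.     *)
Definition tgen (k : nat) : hecke :=
  if insub k is Some i then presclass hecke_rel (T i) else 1.

Definition sgen (j : nat) : hecke :=
  if j == 2 then tgen 0
  else if insub j is Some i then presclass hecke_rel (S i) else 1.

(* s_i s_(i-1) ... s_j, equal to 1 if i < j *)
Definition s_down (i j : nat) : hecke := \prod_(k <- rev (index_iota j i.+1)) sgen k.

(* s_i s_(i+1) ... s_j, equal to 1 if j < i *)
Definition s_up (i j : nat) : hecke := \prod_(k <- index_iota i j.+1) sgen k.

Definition Lambda_two : seq hecke :=
  [:: 1] ++ [seq tgen k | k <- index_iota 0 e]
         ++ [seq tgen k * tgen 0 | k <- index_iota 1 e].

Definition Lambda_ge3 (i : nat) : seq hecke :=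
  [:: 1] ++ [seq s_down i j | j <- index_iota 3 i.+1]
         ++ [seq s_down i 3 * tgen k | k <- index_iota 0 e]
         ++ [seq s_down i 3 * tgen k * s_up 2 j
               | k <- index_iota 1 e, j <- index_iota 2 i.+1].

Definition Lambda_ (i : nat) : seq hecke :=
  if i == 2 then Lambda_two else Lambda_ge3 i.

(* A list, so that is_basis also says that the listed products are pairwise   *)
(* distinct.                                                                  *)
Definition Lambda : seq hecke :=
  foldl (fun L i => [seq x * y | x <- L, y <- Lambda_ i]) [:: 1]
        (index_iota 2 n.+1).

End HeckeRelations.

Arguments Lambda : clear implicits.

(* Main.v *)
(* Independence: let z be a primitive e-th root of 1. Over C[a], H(e,e,n)     *)
(* acts on the functions on words (orderings of letters) through the          *)
(* Ariki-Koike algebra with tau^e = 1, where t_k = tau^-k s_2 tau^k; there is *)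
(* one such action for every colouring of the letters by Z/e. This is the     *)
(* construction of Sakamoto and Shoji: s_j acts by the Hecke operator T that  *)
(* compares two adjacent letters, and                                         *)
(*   tau = T_1^-1 ... T_(n-1)^-1 omega S_(n-1) ... S_1,                       *)
(* where S only compares letters of the same colour and omega is              *)
(* multiplication by z^(colour of the last letter). At a = 0 this is a        *)
(* monomial action of the reflection group, the elements of Lambda yield      *)
(* pairwise distinct monomial matrices, and summing over the colourings       *)
(* separates these. So in a linear relation all coefficients vanish at a = 0, *)
(* and dividing by a gives a relation of smaller degree.                      *)
(* Spanning: by induction on m, the span of Lambda_2 ... Lambda_m is stable   *)
(* under right multiplication by t_k and s_3, ..., s_m. The only delicate     *)
(* product is s_m ... s_3 t_k t_0 s_3 t_l; one expands t_k t_0 in the         *)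
(* elements 1, t_q, t_q t_l and applies t_l s_3 t_l = s_3 t_l s_3.            *)

Require Import Defs.
From mathcomp Require Import all_boot all_order all_algebra.
From mathcomp Require Import algC cyclotomic ring zify boolp.

Set Implicit Arguments.
Unset Strict Implicit.
Unset Printing Implicit Defensive.

Import GRing.Theory Num.Theory.
Local Open Scope ring_scope.

(** * Hecke operators on functions on words *)

(** Spanning is a rewriting argument. By induction on [m], the span of $\Lambda_2\cdots\Lambda_m$ is
    stable under right multiplication by every $t_k$ and by $s_3,\dots,s_m$ ([Lambda_two_stable],
    [step_stable], [Lambda_upto_stable]). It contains 1, so for [m = n] it is the whole algebra
    ([Lambda_span]).

    Independence comes from a family of representations over C[a], one for each colouring of the
    letters ([eact_rel]). They are built from an operator [tau] of order [e] ([tau_order]) that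
    commutes with T_i for i >= 1 ([tau_braid]) and satisfies the type B braid relation with T_0
    ([tau_comm]); t_k acts as the conjugate of T_0 by the k-th power of [tau]. At a = 0 a product of
    generators permutes words and multiplies by a root of unity ([gprod_at0]). Distinct elements of
    $\Lambda$ have distinct permutations or exponents ([nwords_inj]), so Fourier inversion over the
    colourings ([monomial_independence]) kills the constant terms of the coefficients in a linear
    relation. Dividing by a and descending on the degree kills the coefficients themselves
    ([gprod_free]). *)

Record word := Word { word_fun :> nat -> nat; word_inj : injective word_fun }.

Lemma word_ext (v w : word) : v =1 w -> v = w.
Proof.
case: v w => [v vI] [w wI] /= /funext vw; case: _ / vw in wI *.
by congr Word; apply: Prop_irrelevance.
Qed.

Definition swapn (i k : nat) : nat :=
  if k == i then i.+1 else if k == i.+1 then i else k.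

Lemma swapnK i : involutive (swapn i).
Proof. by move=> k; rewrite /swapn; do !case: eqP => //; lia. Qed.

Lemma swapnl i : swapn i i = i.+1.
Proof. by rewrite /swapn eqxx. Qed.

Lemma swapnr i : swapn i i.+1 = i.
Proof. by rewrite /swapn eqxx; case: eqP => //; lia. Qed.

Lemma swapn_out i k : k != i -> k != i.+1 -> swapn i k = k.
Proof. by rewrite /swapn => /negbTE-> /negbTE->. Qed.

(** Acts on positions, not on letters. Words have infinitely many positions, so no bound on [i] is
    needed here or in the relations between swaps. *)
Definition swap (i : nat) (w : word) : word :=
  Word (inj_comp (@word_inj w) (inv_inj (swapnK i))).

Lemma swapK i : involutive (swap i).
Proof. by move=> w; apply: word_ext => k /=; rewrite swapnK. Qed.

Lemma swap_comm i j w : (i.+1 < j)%N -> swap i (swap j w) = swap j (swap i w).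
Proof.
move=> ij; apply: word_ext => k /=; congr (w _).
by rewrite /swapn; do !case: eqP => //; lia.
Qed.

Lemma swap_braid i w :
  swap i (swap i.+1 (swap i w)) = swap i.+1 (swap i (swap i.+1 w)).
Proof.
apply: word_ext => k /=; congr (w _).
by rewrite /swapn; do !case: eqP => //; lia.
Qed.

Lemma swapl i (w : word) : swap i w i = w i.+1.
Proof. by rewrite /= swapnl. Qed.

Lemma swapr i (w : word) : swap i w i.+1 = w i.
Proof. by rewrite /= swapnr. Qed.

Lemma swap_out i k (w : word) : k != i -> k != i.+1 -> swap i w k = w k.
Proof. by move=> ki ki1; rewrite /= swapn_out. Qed.

Arguments swap : simpl never.

Lemma word_neq (w : word) i j : i != j -> w i != w j.
Proof. by rewrite (inj_eq (@word_inj w)). Qed.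

Section Operators.

Variable R : comNzRingType.
Implicit Types (f : word -> R) (h : nat -> nat -> R).

(** The common shape of T, its inverse and S, which differ only in the coefficient [h]; commutation
    and braid relations are proved once for this shape. *)
Definition cross h i f : word -> R :=
  fun w => f (swap i w) + h (w i) (w i.+1) * f w.

Lemma cross2 g h i f w :
  cross g i (cross h i f) w =
  (1 + g (w i) (w i.+1) * h (w i) (w i.+1)) * f w
  + (g (w i) (w i.+1) + h (w i.+1) (w i)) * f (swap i w).
Proof. by rewrite /cross swapK swapl swapr; ring. Qed.

Lemma cross_comm g h i j f :
  (i.+1 < j)%N -> cross g i (cross h j f) = cross h j (cross g i f).
Proof.
move=> ij; apply/funext => w; rewrite /cross (swap_comm _ ij).
by rewrite !swap_out; [ring | lia..].
Qed.

(* In [cross_braid], these equate the coefficients of [f (swap i w)],         *)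
(* [f (swap i.+1 w)] and [f w].                                               *)
Definition yang_baxter h1 h2 h3 := forall x y z : nat,
  x != y -> y != z -> x != z ->
  [/\ h2 x z * h3 y x + h1 x y * h2 y z = h3 y z * h1 x z,
      h1 x y * h3 x z = h2 x z * h1 z y + h3 y z * h2 x y
    & h1 x y * h2 y z * h3 x y = h3 y z * h2 x y * h1 y z].

Lemma cross_braid h1 h2 h3 i f : yang_baxter h1 h2 h3 ->
  cross h1 i (cross h2 i.+1 (cross h3 i f)) =
  cross h3 i.+1 (cross h2 i (cross h1 i.+1 f)).
Proof.
move=> yb; apply/funext => w.
set x := w i; set y := w i.+1; set z := w i.+2.
have [||| e1 e2 e3] := yb x y z; try by apply: word_neq; lia.
have o0 v : swap i v i.+2 = v i.+2 by apply: swap_out; lia.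
have o1 v : swap i.+1 v i = v i by apply: swap_out; lia.
rewrite /cross !(swapl, swapr, o0, o1, swapK) swap_braid.
rewrite -/x -/y -/z.
set f0 := f w; set f1 := f (swap i w); set f2 := f (swap i.+1 w).
apply: subr0_eq; transitivity (
  (h2 x z * h3 y x + h1 x y * h2 y z - h3 y z * h1 x z) * f1
  + (h1 x y * h3 x z - (h2 x z * h1 z y + h3 y z * h2 x y)) * f2
  + (h1 x y * h2 y z * h3 x y - h3 y z * h2 x y * h1 y z) * f0).
  by rewrite /x /y /z; ring.
by rewrite e1 e2 e3 !subrr !mul0r !addr0.
Qed.

End Operators.

(** The three equations are homogeneous, of degrees 2, 2 and 3, so it suffices to check them on
    integer coefficients. *)
Lemma yang_baxter_scale (R : comNzRingType) (a : R)
    (h1 h2 h3 : nat -> nat -> int) :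
  yang_baxter h1 h2 h3 ->
  yang_baxter (fun x y => a * (h1 x y)%:~R) (fun x y => a * (h2 x y)%:~R)
    (fun x y => a * (h3 x y)%:~R).
Proof.
move=> yb x y z xy yz xz; have [e1 e2 e3] := yb x y z xy yz xz.
move: (congr1 (fun k : int => a * a * k%:~R) e1)
      (congr1 (fun k : int => a * a * k%:~R) e2)
      (congr1 (fun k : int => a * a * a * k%:~R) e3) => {}e1 {}e2 {}e3.
rewrite !(intrD, intrM) in e1 e2 e3.
split.
- transitivity (a * a * ((h2 x z)%:~R * (h3 y x)%:~R
    + (h1 x y)%:~R * (h2 y z)%:~R)); [ring | rewrite e1; ring].
- transitivity (a * a * ((h1 x y)%:~R * (h3 x z)%:~R));
    [ring | rewrite e2; ring].
- transitivity (a * a * a * ((h1 x y)%:~R * (h2 y z)%:~R * (h3 x y)%:~R));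
    [ring | rewrite e3; ring].
Qed.

(** * Coloured operators and the Ariki-Koike element [tau] *)

Section ColouredOperators.

Variables (R : comNzRingType) (a : R) (u : nat -> R) (c : nat -> nat).
Implicit Types (f : word -> R).

(** Colours dominate in this order of the letters; this is what makes [tau] triangular in
    [tau_triangular]. *)
Definition before (x y : nat) : bool :=
  (c x < c y)%N || (c x == c y) && (x < y)%N.

Definition hT x y : int := (before y x)%:R.
(** On distinct letters this is [hT x y - 1], so that [opU] is [opT - a], the inverse given by the
    quadratic relation. *)
Definition hU x y : int := - (before x y)%:R.
Definition hS x y : int := ((c x == c y) && before y x)%:R.

Definition cT x y : R := a * (hT x y)%:~R.
Local Notation opT := (cross cT).
Definition cU x y : R := a * (hU x y)%:~R.
Local Notation opU := (cross cU).
Definition cS x y : R := a * (hS x y)%:~R.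
Local Notation opS := (cross cS).
Definition opD (i : nat) f : word -> R := fun w => u (c (w i)) * f w.

Lemma before_anti x y : x != y -> before y x = ~~ before x y.
Proof. by rewrite /before; case: (ltngtP (c x) (c y)); case: (ltngtP x y). Qed.

Let neqS (w : word) i : w i != w i.+1.
Proof. by apply: word_neq; lia. Qed.

Lemma opTU i : cancel (opU i) (opT i).
Proof.
move=> f; apply/funext => w; rewrite cross2 /cT /cU /hT /hU.
by rewrite (before_anti (neqS w i)); case: before => /=; ring.
Qed.

Lemma opUT i : cancel (opT i) (opU i).
Proof.
move=> f; apply/funext => w; rewrite cross2 /cT /cU /hT /hU.
by rewrite (before_anti (neqS w i)); case: before => /=; ring.
Qed.

Lemma opT_quad i f w : opT i (opT i f) w = a * opT i f w + f w.
Proof.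
rewrite cross2 /cross /cT /hT (before_anti (neqS w i)).
by case: before => /=; ring.
Qed.

(** Transitivity of the order and convexity of the colour classes: they exclude the impossible
    patterns when the Yang-Baxter equations are checked by cases on all comparisons of three
    letters. *)
Lemma before_convex x y z :
  [/\ (before x y && before y z ==> before x z)
        && (before x z ==> before x y || before y z),
      (before x y && before y z) || (before z y && before y x) ==>
        (c x == c z) ==> (c x == c y),
      (before x z && before z y) || (before y z && before z x) ==>
        (c x == c y) ==> (c x == c z),
      (before y x && before x z) || (before z x && before x y) ==>
        (c y == c z) ==> (c x == c z)
    & [&& (c x == c y) && (c y == c z) ==> (c x == c z),
          (c x == c y) && (c x == c z) ==> (c y == c z)
        & (c x == c z) && (c y == c z) ==> (c x == c y)]].
Proof. by rewrite /before; split; lia. Qed.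

Local Ltac solve_yang_baxter :=
  let i := fresh "i" in let f := fresh "f" in
  move=> i f; apply: cross_braid; rewrite /cT /cU /cS; apply: yang_baxter_scale;
  let x := fresh "x" in let y := fresh "y" in let z := fresh "z" in
  let xy := fresh "xy" in let yz := fresh "yz" in let xz := fresh "xz" in
  move=> x y z xy yz xz; move: (before_convex x y z); rewrite /hT /hU /hS;
  rewrite ?(before_anti xy) ?(before_anti yz) ?(before_anti xz);
  rewrite ?(eq_sym (c y) (c x)) ?(eq_sym (c z) (c x)) ?(eq_sym (c z) (c y));
  case: (before x y); case: (before y z); case: (before x z);
  case: (c x == c y); case: (c y == c z); case: (c x == c z) => //=; by case.

Lemma braidTTT i f : opT i (opT i.+1 (opT i f)) = opT i.+1 (opT i (opT i.+1 f)).
Proof. by move: i f; solve_yang_baxter. Qed.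

Lemma braidUUT i f : opU i (opU i.+1 (opT i f)) = opT i.+1 (opU i (opU i.+1 f)).
Proof. by move: i f; solve_yang_baxter. Qed.

Lemma braidTUU i f : opT i (opU i.+1 (opU i f)) = opU i.+1 (opU i (opT i.+1 f)).
Proof. by move: i f; solve_yang_baxter. Qed.

Lemma braidSSS i f : opS i (opS i.+1 (opS i f)) = opS i.+1 (opS i (opS i.+1 f)).
Proof. by move: i f; solve_yang_baxter. Qed.

Lemma braidSST i f : opS i (opS i.+1 (opT i f)) = opT i.+1 (opS i (opS i.+1 f)).
Proof. by move: i f; solve_yang_baxter. Qed.

Lemma braidTSS i f : opT i (opS i.+1 (opS i f)) = opS i.+1 (opS i (opT i.+1 f)).
Proof. by move: i f; solve_yang_baxter. Qed.

Lemma braidUSS i f : opU i (opS i.+1 (opS i f)) = opS i.+1 (opS i (opU i.+1 f)).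
Proof. by move: i f; solve_yang_baxter. Qed.

Lemma crossD h i j f : j != i -> j != i.+1 ->
  cross h i (opD j f) = opD j (cross h i f).
Proof.
by move=> ji ji1; apply/funext => w; rewrite /cross /opD swap_out //; ring.
Qed.

(** The product U_j ... U_(j+m-1) D_(j+m) S_(j+m-1) ... S_j. The start [j] varies so that inductions
    can peel off the outermost pair U_j, S_j. *)
Fixpoint tau (m j : nat) f : word -> R :=
  if m is m'.+1 then opU j (tau m' j.+1 (opS j f)) else opD j f.

Lemma tau_far h m j i f : (i.+1 < j)%N ->
  cross h i (tau m j f) = tau m j (cross h i f).
Proof.
elim: m j f => [|m IH] j f ij /=; first by rewrite crossD //; lia.
by rewrite (cross_comm _ _ _ ij) IH ?(cross_comm _ _ _ ij) //; lia.
Qed.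

(** Outer pairs commute with T_i until [i = j.+1]. There [braidUUT] turns T_(j+1) into T_j, which
    passes the inner [tau], and [braidTSS] turns it back. *)
Lemma tau_braid m j i f : (j < i < j + m)%N ->
  opT i (tau m j f) = tau m j (opT i f).
Proof.
elim: m j f => [|m IH] j f ij; first lia.
have [->|nij] := eqVneq i j.+1.
  case: m IH ij => [|m] IH ij /=; first lia.
  by rewrite -braidUUT (tau_far _ _ _ (ltnSn _)) -braidTSS.
have ji : (j.+1 < i)%N by lia.
by rewrite /= -(cross_comm _ _ _ ji) IH -?(cross_comm _ _ _ ji) //; lia.
Qed.

(** Places the shorter square, of parameters [m] and [j.+2], between U_(j+1) U_j and S_j S_(j+1).
    Through these factors T_j becomes T_(j+1) and returns, which is the induction step of
    [tau_reflection]. *)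
Lemma tau_square m j f :
  tau m.+1 j.+1 (opS j (tau m.+1 j.+1 (opS j f))) =
  opU j.+1 (opU j (tau m j.+2 (opS j.+1 (tau m j.+2
    (opS j.+1 (opS j (opS j.+1 f))))))).
Proof.
rewrite /= -braidUSS; congr opU.
by rewrite -(tau_far _ _ _ (ltnSn _)) [opS j (tau _ _ _)]tau_far ?braidSSS.
Qed.

(** In the base case, if the two letters have the same colour then D is a scalar on them and S is T.
    Otherwise S is the plain swap and the square multiplies by a quantity symmetric in the two
    colours. *)
Lemma tau_reflection m j f :
  opT j (tau m j.+1 (opS j (tau m j.+1 (opS j f)))) =
  tau m j.+1 (opS j (tau m j.+1 (opS j (opT j f)))).
Proof.
elim: m j f => [|m IH] j f; last first.
  by rewrite !tau_square braidSST -IH braidTUU.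
apply/funext => w; rewrite /= /opD /cross /cT /cS !(swapl, swapr, swapK).
rewrite /hT /hS (before_anti (neqS w j)) (eq_sym (c (w j.+1))).
by case: eqP => [->|_]; case: before; rewrite /=; ring.
Qed.

(** The type B braid relation. Since T_j cancels the leading U_j of [tau], it reduces to
    [tau_reflection]. *)
Lemma tau_comm m j f :
  tau m.+1 j (opT j (tau m.+1 j (opT j f))) =
  opT j (tau m.+1 j (opT j (tau m.+1 j f))).
Proof. by rewrite /= !opTU -tau_reflection opUT. Qed.

Definition vanish (k j : nat) f := forall w : word, (k <= c (w j))%N -> f w = 0.

(** For the filtration by the colour at position [j], [tau] is triangular with diagonal entries
    [u k]. The correction from U_j occurs only if [w j] precedes [w j.+1]. For equal colours it
    cancels the correction from S_j; otherwise [w j.+1] has larger colour and the values of [f]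
    involved vanish. *)
Lemma tau_triangular m j k f (w : word) : vanish k.+1 j f ->
  (k <= c (w j))%N -> tau m j f w = u (c (w j)) * f w.
Proof.
elim: m j f w => [|m IH] j f w f0 kw //=.
have g0 : vanish k.+1 j.+1 (opS j f).
  move=> v kv; rewrite /cross /cS f0 ?swapl // add0r /hS.
  by case: eqP => [e|_]; rewrite ?(mul0r, mulr0) // f0 ?mulr0 // e.
rewrite {1}/cross (IH _ _ (swap j w) g0) ?swapr //.
rewrite {1}/cross swapl swapr swapK /cU /cS /hU /hS.
rewrite (eq_sym (c (w j.+1))).
have [b|_] := boolP (before (w j) (w j.+1)); last by rewrite andbF /=; ring.
have kw1 : (k <= c (w j.+1))%N by move: b; rewrite /before; lia.
rewrite (IH _ _ w g0) // /cross /cS /hS (before_anti (neqS w j)) b andbF.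
case: eqP => [->|e] /=; first by ring.
by rewrite (f0 (swap j w)) ?swapl; [ring | move: b; rewrite /before; lia].
Qed.

Definition linop (F : (word -> R) -> word -> R) := forall b f g,
  F (fun w => b * f w + g w) = fun w => b * F f w + F g w.

Lemma linop_cross h i : linop (cross h i).
Proof. by move=> b f g; apply/funext => w; rewrite /cross; ring. Qed.

Lemma linop_comp F G : linop F -> linop G -> linop (F \o G).
Proof. by move=> FL GL b f g; rewrite /= GL FL. Qed.

Lemma linop_iter F k : linop F -> linop (iter k F).
Proof. by move=> FL; elim: k => [|k IH] b f g //; rewrite !iterS IH FL. Qed.

Lemma linop_tau m j : linop (tau m j).
Proof.
elim: m j => [|m IH] j b f g; last by rewrite /= linop_cross IH linop_cross.
by apply/funext => w; rewrite /= /opD; ring.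
Qed.

Lemma linop0 F w : linop F -> F (fun=> 0) w = 0.
Proof.
move=> /(_ (-1) (fun=> 0) (fun=> 0)); rewrite !mulr0 addr0.
by move=> /(congr1 (@^~ w)) /= ->; ring.
Qed.

Lemma linopD F f g : linop F ->
  F (fun w => f w + g w) = fun w => F f w + F g w.
Proof.
move=> FL; rewrite (_ : (fun w => _) = fun w => 1 * f w + g w).
  by rewrite FL; apply/funext => w; rewrite mul1r.
by apply/funext => w; rewrite mul1r.
Qed.

Lemma linopZ F b f : linop F -> F (fun w => b * f w) = fun w => b * F f w.
Proof.
move=> FL; rewrite (_ : (fun w => _) = fun w => b * f w + (fun=> 0) w).
  by rewrite FL; apply/funext => w; rewrite (linop0 _ FL) addr0.
by apply/funext => w; rewrite addr0.
Qed.

Definition poly_op (F : (word -> R) -> word -> R) (p : {poly R}) f :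
    word -> R :=
  fun w => \sum_(i < size p) p`_i * iter i F f w.

Lemma poly_opE N F (p : {poly R}) f w : (size p <= N)%N ->
  poly_op F p f w = \sum_(i < N) p`_i * iter i F f w.
Proof.
move=> pN; rewrite /poly_op (big_ord_widen N (fun i => p`_i * iter i F f w) pN).
rewrite big_mkcond; apply: eq_bigr => i _; case: ltnP => // pi.
by rewrite nth_default ?mul0r.
Qed.

Lemma poly_op_mulXsubC F (p : {poly R}) b f : linop F ->
  poly_op F (p * ('X - b%:P)) f = poly_op F p (fun w => (- b) * f w + F f w).
Proof.
move=> FL; apply/funext => w.
rewrite (@poly_opE (size p).+1); last first.
  by apply: leq_trans (size_polyMleq _ _) _; rewrite size_XsubC addn2.
rewrite (@poly_opE (size p)) //.
under eq_bigr do rewrite mulrBr coefB coefMX coefMC mulrBl.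
under [in RHS]eq_bigr do rewrite (linop_iter _ FL) -iterSr mulrDr.
rewrite sumrB big_split /= addrC; congr (_ + _).
  by rewrite big_ord_recl /= mul0r add0r.
rewrite big_ord_recr /= nth_default // !mul0r addr0 -sumrN.
by apply: eq_bigr => i _; ring.
Qed.

Lemma tau_vanish m j k f : vanish k.+1 j f ->
  vanish k j (fun w => (- u k) * f w + tau m j f w).
Proof.
move=> f0 w kw; rewrite (tau_triangular _ f0 kw).
by move: kw; rewrite leq_eqVlt => /predU1P[->|/f0->]; ring.
Qed.

(** Each factor lowers the filtration by one step ([tau_vanish]), and only the zero function is at
    level 0. *)
Lemma poly_op_tau_vanish m j k f : vanish k j f ->
  poly_op (tau m j) (\prod_(0 <= i < k) ('X - (u i)%:P)) f = fun=> 0.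
Proof.
elim: k f => [|k IH] f f0.
  rewrite (_ : f = fun=> 0); last by apply/funext => w; apply: f0.
  apply/funext => w; rewrite /poly_op big1 // => i _.
  by rewrite (linop0 _ (linop_iter _ (linop_tau m j))) mulr0.
rewrite big_nat_recr //= (poly_op_mulXsubC _ _ _ (linop_tau m j)).
exact/IH/tau_vanish.
Qed.

(** A Cayley-Hamilton argument: every function lies at level [e] of the filtration, so the product
    over all eigenvalues, which is ['X^e - 1], annihilates it. *)
Lemma tau_order m j e : (forall x, c x < e)%N ->
  \prod_(0 <= i < e) ('X - (u i)%:P) = 'X^e - 1 :> {poly R} ->
  iter e (tau m j) =1 id.
Proof.
move=> ce prodE f; apply/funext => w.
case: e ce prodE => [|e] ce prodE; first by have := ce 0%N.
have f0 : vanish e.+1 j f by move=> v; rewrite leqNgt ce.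
have /(congr1 (@^~ w)) := poly_op_tau_vanish m f0.
rewrite prodE (@poly_opE e.+2) ?size_XnsubC //.
rewrite big_ord_recr big_ord_recl !coefB !coefXn !coef1 !eqxx.
rewrite big1 => [|i _].
  by rewrite /= => e1; apply: subr0_eq; rewrite -[RHS]e1; ring.
by rewrite coefB coefXn coef1 /= eqSS ltn_eqF ?subr0 ?mul0r ?ltn_ord.
Qed.

End ColouredOperators.

(** * The action of the Hecke algebra *)

Section HeckeModule.

Variables (e n : nat) (z : algC) (c : nat -> nat).
Hypotheses (n2 : (2 <= n)%N) (z_prim : e.-primitive_root z).
Hypothesis c_lt : forall x, (c x < e)%N.

Local Notation R := {poly algC}.
Implicit Types (f : word -> R).

Definition opTX i := cross (cT ('X : R) c) i.
Definition opX := tau ('X : R) (fun k => (z ^+ k)%:P) c n.-1 0.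

Lemma linop_T i : linop (opTX i).
Proof. exact: linop_cross. Qed.

Lemma linop_X : linop opX.
Proof. exact: linop_tau. Qed.

Lemma opX_order f : iter e opX f = f.
Proof.
apply: tau_order => //.
have := congr1 (map_poly polyC) (factor_Xn_sub_1 z_prim).
rewrite rmorph_prod rmorphB /= map_polyXn rmorph1 => <-.
by apply: eq_bigr => i _; rewrite rmorphB /= map_polyX map_polyC.
Qed.

Lemma opX_iter_mod k l f : k = l %[mod e] -> iter k opX f = iter l opX f.
Proof.
suff iterE m : iter m opX f = iter (m %% e) opX f.
  by move=> kl; rewrite iterE kl -iterE.
rewrite {1}(divn_eq m e) addnC iterD; congr (iter _ _ _).
by rewrite iterM; elim: (m %/ e)%N => //= q {2}<-; rewrite opX_order.
Qed.

Let e_gt0 : (0 < e)%N := leq_ltn_trans (leq0n _) (c_lt 0).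

Lemma opXV k : cancel (iter (k * e.-1) opX) (iter k opX).
Proof.
move=> f; rewrite -iterD (@opX_iter_mod _ 0) // -mulnS prednK //.
by rewrite modnMl mod0n.
Qed.

Lemma opVX k : cancel (iter k opX) (iter (k * e.-1) opX).
Proof.
move=> f; rewrite -iterD (@opX_iter_mod _ 0) // addnC -mulnS prednK //.
by rewrite modnMl mod0n.
Qed.

Lemma opX_T k i f : (0 < i)%N -> (i < n.-1)%N ->
  opTX i (iter k opX f) = iter k opX (opTX i f).
Proof.
move=> i0 i_n; elim: k => //= k IH; rewrite -IH.
by apply: tau_braid; rewrite i0 add0n.
Qed.

Lemma opX_TXT k f :
  opTX 0 (opX (opTX 0 (iter k opX f))) = iter k opX (opTX 0 (opX (opTX 0 f))).
Proof.
elim: k => //= k <-; rewrite /opTX /opX -(subnKC n2) /=.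
by rewrite -tau_comm.
Qed.

(** The conjugate of T_0 by the k-th power of [opX]. As [opX] has order [e], the exponent [k * e.-1]
    stands for -k. *)
Definition opt k f := iter (k * e.-1) opX (opTX 0 (iter k opX f)).

Lemma linop_t k : linop (opt k).
Proof.
have Xk m := linop_iter m linop_X.
exact: linop_comp (Xk _) (linop_comp (linop_T 0) (Xk k)).
Qed.

Definition gact (x : hgen e n) : (word -> R) -> word -> R :=
  match x with GT i => opt i | GS j => opTX (val j - 2) end.

Definition scal (k : {poly int}) : R := map_poly intr k.

(** Arbitrary operators on functions violate right distributivity, so the values are plain functions
    and [linop_eact] supplies the linearity that [eact_cong] needs. *)
Fixpoint eact (x : expr {poly int} (hgen e n)) : (word -> R) -> word -> R :=
  match x with
  | EVar x => gact x
  | EZero => fun _ _ => 0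
  | EOne => id
  | EOpp x => fun f w => - eact x f w
  | EAdd x y => fun f w => eact x f w + eact y f w
  | EMul x y => fun f => eact x (eact y f)
  | EScale k x => fun f w => scal k * eact x f w
  end.

Lemma linop_eact x : linop (eact x).
Proof.
elim: x => [[i|j]|||x IH|x IHx y IHy|x IHx y IHy|k x IH] //= b f g.
- exact: linop_t.
- exact: linop_T.
- by apply/funext => w; ring.
- by apply/funext => w; rewrite IH; ring.
- by apply/funext => w; rewrite IHx IHy; ring.
- by rewrite IHy IHx.
- by apply/funext => w; rewrite IH; ring.
Qed.

Lemma opt_quad k f w : opt k (opt k f) w = 'X * opt k f w + f w.
Proof.
rewrite /opt opXV.
have -> : opTX 0 (opTX 0 (iter k opX f)) =
    fun v => 'X * opTX 0 (iter k opX f) v + iter k opX f v.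
  by apply/funext => v; apply: opT_quad.
by rewrite (linop_iter _ linop_X) opVX.
Qed.

(** The exponent between the two factors T_0 is 1 modulo [e]. The resulting T_0 X T_0 commutes with
    X by [opX_TXT], and the remaining power is the inverse of X, whatever [i] is. *)
Lemma opt_opt (i : 'I_e) f :
  opt i (opt (ord_pred i) f) = iter e.-1 opX (opTX 0 (opX (opTX 0 f))).
Proof.
rewrite /opt -[iter i opX _]iterD.
have [d1 d2] : (i + ord_pred i * e.-1)%N = 1 %[mod e] /\
    (i * e.-1 + ord_pred i)%N = e.-1 %[mod e].
  have ie := ltn_ord i; rewrite /=.
  (* The cyclic predecessor of 0 is [e.-1], so this case is computed apart. *)
  have [-> | i0] := posnP i.
    rewrite ?mul0n !add0n modn_mod -modnMml modn_mod modnMml; split=> //.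
    case: (e) e_gt0 => // -[|d] _ //=.
    by rewrite (_ : (d.+1 * d.+1 = d * d.+2 + 1)%N) ?modnMDl //; lia.
  rewrite (_ : ((i + e).-1 %% e)%N = i.-1); last first.
    by rewrite (_ : (i + e).-1 = (i.-1 + e)%N) ?modnDr ?modn_small //; lia.
  case: (i : nat) i0 {ie} => // k _ /=; rewrite -(prednK e_gt0) /=.
  move: e.-1 => d; split.
    by rewrite (_ : (k.+1 + k * d = k * d.+1 + 1)%N) ?modnMDl //; lia.
  by rewrite (_ : (k.+1 * d + k = k * d.+1 + d)%N) ?modnMDl //; lia.
rewrite (opX_iter_mod _ d1) /= opX_TXT -iterD.
exact: opX_iter_mod.
Qed.

Lemma eact_rel x y : hecke_rel x y -> eact x = eact y.
Proof.
case=> {x y} /= [i j|i j j3|i j j4|i j ij|i j ij|i|j]; apply/funext => f.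
- by rewrite !opt_opt.
- have n3 : (1 < n.-1)%N by have := valP j; rewrite /= j3; lia.
  have -> : (sval j - 2)%N = 1%N by rewrite j3.
  rewrite /opt (@opX_T _ 1) // opXV (@opX_T _ 1) //.
  by rewrite -(@opX_T i 1 f) // /opTX braidTTT.
- case: j j4 => j jn /= j4.
  have [j1 jn1] : (1 < j - 2)%N /\ (j - 2 < n.-1)%N by lia.
  rewrite /opt opX_T ?(ltnW j1) // -(@opX_T i (j - 2) f) ?(ltnW j1) //.
  by rewrite /opTX (cross_comm _ _ _ j1).
- case: i j ij => [i iP] [j jP] /= ->.
  by rewrite subSn ?/opTX ?braidTTT //; lia.
- case: i j ij => [i iP] [j jP] /= /orP[] ij.
    by rewrite /opTX cross_comm //; lia.
  by rewrite /opTX [RHS]cross_comm //; lia.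
- by apply/funext => w; rewrite opt_quad /scal map_polyX; ring.
- apply/funext => w; rewrite [opTX _ (opTX _ _) _]opT_quad /scal map_polyX.
  by rewrite /opTX; ring.
Qed.

Lemma eact_cong x y : prescong (@hecke_rel e n) x y -> eact x = eact y.
Proof.
elim=> {x y}; first by move=> *; apply: eact_rel.
all: move=> * /=; apply/funext => f; apply/funext => w.
all: rewrite ?(linopD _ _ (linop_eact _)) ?(linopZ _ _ (linop_eact _)).
all: rewrite ?/scal ?(rmorphM, rmorphD, rmorph1); by [ring | congruence].
Qed.

Definition hact (x : hecke e n) := eact (repr x).

Lemma hactE x : hact (presclass _ x) = eact x.
Proof. exact/eact_cong/presrepr. Qed.

Lemma hact1 f : hact 1 f = f.
Proof. by rewrite -presclass1 hactE. Qed.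

Lemma hactM x y f : hact (x * y) f = hact x (hact y f).
Proof.
have [[p ->] [q ->]] := (presclass_surj x, presclass_surj y).
by rewrite -presclassM !hactE.
Qed.

Lemma hactD x y f w : hact (x + y) f w = hact x f w + hact y f w.
Proof.
have [[p ->] [q ->]] := (presclass_surj x, presclass_surj y).
by rewrite -presclassD !hactE.
Qed.

Lemma hactZ k x f w : hact (k *: x) f w = scal k * hact x f w.
Proof. by have [p ->] := presclass_surj x; rewrite -presclassZ !hactE. Qed.

Lemma hact0 f w : hact 0 f w = 0.
Proof. by rewrite -presclass0 hactE. Qed.

Lemma hact_sum N (k : 'I_N -> {poly int}) (x : 'I_N -> hecke e n) f w :
  hact (\sum_i k i *: x i) f w = \sum_i scal (k i) * hact (x i) f w.
Proof.
elim/big_ind2: _ => [|p p' q q' pp' qq'|i _]; first exact: hact0.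
- by rewrite hactD pp' qq'.
- exact: hactZ.
Qed.

Lemma hact_tgen k : (k < e)%N -> hact (tgen e n k) = opt k.
Proof. by move=> ke; rewrite /tgen insubT hactE. Qed.

Lemma opt0 : opt 0 = opTX 0.
Proof. by apply/funext => f; rewrite /opt. Qed.

Lemma hact_sgen k : (2 <= k <= n)%N -> hact (sgen e n k) = opTX (k - 2).
Proof.
move=> kn; rewrite /sgen; have [->|k2] := eqVneq k 2.
  by rewrite hact_tgen // opt0.
have k3 : (3 <= k <= n)%N by lia.
by rewrite insubT hactE.
Qed.

(** * Specialization at a = 0: monomial matrices *)

Definition gval (g : nat + nat) : hecke e n :=
  match g with inl k => tgen e n k | inr j => sgen e n j end.

Definition gprod (l : seq (nat + nat)) : hecke e n := \prod_(g <- l) gval g.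

Definition gvalid (g : nat + nat) :=
  match g with inl k => (k < e)%N | inr j => (2 <= j <= n)%N end.

Definition gswap (g : nat + nat) : word -> word :=
  swap (if g is inr j then j - 2 else 0%N).

(** The phase of t_k at a = 0 is z to the power k times (colour of [w 1] minus colour of [w 0]);
    this is the multiplicity in it of the colour of [x], with [k * e.-1] for -k. *)
Definition gshift (g : nat + nat) (w : word) (x : nat) : nat :=
  if g is inl k then (k * e.-1 * (x == w 0) + k * (x == w 1))%N else 0%N.

Definition wact (l : seq (nat + nat)) (w : word) : word :=
  foldl (fun v g => gswap g v) w l.

Fixpoint pexp (l : seq (nat + nat)) (w : word) (x : nat) : nat :=
  if l is g :: l' then (gshift g w x + pexp l' (gswap g w) x)%N else 0%N.

Hypothesis c_supp : forall x, (n <= x)%N -> c x = 0%N.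

Lemma opTX_at0 i f w : (opTX i f w).[0] = (f (swap i w)).[0].
Proof. by rewrite /opTX /cross /cT !(hornerE, mul0r) ?addr0. Qed.

Lemma tau_at0 m j f w :
  (tau ('X : R) (fun k => (z ^+ k)%:P) c m j f w).[0] =
  z ^+ c (w j) * (f w).[0].
Proof.
elim: m j f w => [|m IH] j f w /=; first by rewrite /opD !hornerE.
rewrite /cross /cU !(hornerE, mul0r) ?addr0 IH swapr.
by rewrite /cross /cS !(hornerE, mul0r) ?addr0 swapK.
Qed.

Lemma opX_iter_at0 k f w :
  (iter k opX f w).[0] = z ^+ (k * c (w 0)) * (f w).[0].
Proof.
elim: k => [|k IH]; first by rewrite mul1r.
by rewrite iterS tau_at0 IH mulrA -exprD mulSn.
Qed.

Lemma opt_at0 k f w : (opt k f w).[0] =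
  z ^+ (k * e.-1 * c (w 0) + k * c (w 1)) * (f (swap 0 w)).[0].
Proof.
by rewrite /opt opX_iter_at0 opTX_at0 opX_iter_at0 swapl mulrA exprD.
Qed.

Lemma sum_delta (m y : nat) :
  (\sum_(x < n) m * (x == y :> nat) * c x = m * c y)%N.
Proof.
have [yn|ny] := ltnP y n; last first.
  rewrite (c_supp ny) muln0 big1 // => x _.
  by rewrite ltn_eqF ?muln0 // (leq_trans (ltn_ord x)).
rewrite (bigD1 (Ordinal yn)) //= eqxx muln1 big1 ?addn0 // => x xy.
by rewrite (_ : (x == y :> nat) = false) ?muln0 //; apply/negbTE.
Qed.

Lemma gprod_at0 l f w : all gvalid l -> (hact (gprod l) f w).[0] =
  z ^+ (\sum_(x < n) pexp l w x * c x)%N * (f (wact l w)).[0].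
Proof.
elim: l w => [|g l IH] w /=.
  by rewrite /gprod big_nil hact1 big1 ?mul1r // => x _; rewrite mul0n.
case/andP => gv lv; rewrite /gprod big_cons hactM -/(gprod l).
under eq_bigr do rewrite mulnDl.
rewrite big_split exprD /= -mulrA -IH //.
case: g gv => [k|j] /= gv.
  rewrite hact_tgen // opt_at0; congr (z ^+ _ * _).
  by under eq_bigr do rewrite mulnDl; rewrite big_split /= !sum_delta.
by rewrite hact_sgen // opTX_at0 big1 ?mul1r // => x _; rewrite mul0n.
Qed.

End HeckeModule.

(** * Linear independence from the monomial action *)

Lemma unity_root_sum (F : fieldType) (e : nat) (r : F) :
  r ^+ e = 1 -> r != 1 -> \sum_(i < e) r ^+ i = 0.
Proof.
move=> re r1; apply/eqP; have /eqP := subrX1 r e.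
by rewrite re subrr eq_sym mulf_eq0 subr_eq0 (negbTE r1).
Qed.

(** Fourier inversion. Take for [f] the indicator of [w i0], divide by the phase of [i0] and sum
    over all colourings [q]. The term of [i0] gives [k i0] times the number of colourings. Any other
    term with the same target splits into geometric sums, one per letter, and one of them vanishes
    because some exponents differ modulo [e]. *)
Lemma monomial_independence (e n N : nat) (z : algC) (T : Type)
    (k : 'I_N -> algC) (p : 'I_N -> nat -> nat) (w : 'I_N -> T) :
  (0 < e)%N -> e.-primitive_root z ->
  (forall i j, w i = w j ->
     (forall x : 'I_n, p i x = p j x %[mod e]) -> i = j) ->
  (forall (q : {ffun 'I_n -> 'I_e}) (f : T -> algC),
     \sum_i k i * (z ^+ (\sum_(x < n) p i x * q x)%N * f (w i)) = 0) ->
  forall i, k i = 0.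
Proof.
move=> e0 z_prim inj k0 i0.
have z0 : z != 0 by apply: contraTneq isT => z0; have := prim_expr_order z_prim;
  rewrite z0 expr0n gtn_eqF // => /eqP; rewrite eq_sym oner_eq0.
pose f v : algC := (`[< v = w i0 >])%:R.
have : \sum_(q : {ffun 'I_n -> 'I_e}) (z ^+ (\sum_(x < n) p i0 x * q x)%N)^-1 *
   (\sum_i k i * (z ^+ (\sum_(x < n) p i x * q x)%N * f (w i))) = 0.
  by rewrite big1 // => q _; rewrite k0 mulr0.
under eq_bigr do rewrite mulr_sumr.
rewrite exchange_big /= (bigD1 i0) //= [X in _ + X]big1 ?addr0 => [|i ii0].
  rewrite /f asboolT // (eq_bigr (fun=> k i0)) => [|q _].
    move=> /eqP; rewrite sumr_const card_ffun !card_ord -mulr_natr mulf_eq0.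
    rewrite pnatr_eq0 expn_eq0 (gtn_eqF e0) orbF.
    by move/eqP.
  by rewrite mulr1 mulrC mulfK // expf_neq0.
rewrite /f; have [wi|] := boolP `[< w i = w i0 >]; last first.
  by move=> _; rewrite big1 // => q _; rewrite !mulr0.
have [x px] : exists x : 'I_n, p i x != p i0 x %[mod e].
  apply/existsP; rewrite -negb_forall; apply: contra ii0 => /forallP pE.
  by apply/eqP/inj => [|x]; [exact/asboolP | exact/eqP].
pose r (x : nat) := z ^+ p i x / z ^+ p i0 x.
rewrite (eq_bigr
  (fun q : {ffun 'I_n -> 'I_e} => k i * \prod_(x < n) r x ^+ q x)).
  rewrite -mulr_sumr -(bigA_distr_bigA (fun (x : 'I_n) (j : 'I_e) => r x ^+ j)).
  rewrite (bigD1 x) //= unity_root_sum ?mul0r ?mulr0 //.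
    by rewrite exprMn exprVn -!exprM ![(p _ _ * e)%N]mulnC !exprM
      (prim_expr_order z_prim) !expr1n divr1.
  rewrite -subr_eq0 -(mulfV (expf_neq0 (p i0 x) z0)) -mulrBl mulf_eq0.
  rewrite invr_eq0 (negbTE (expf_neq0 _ z0)) orbF subr_eq0.
  by rewrite (eq_prim_root_expr z_prim).
move=> q _; rewrite mulr1 mulrCA; congr (_ * _).
rewrite -!prodrXr -prodfV -big_split; apply: eq_bigr => y _ /=.
by rewrite exprMn exprVn -!exprM mulrC.
Qed.

Definition word0 : word := Word (@inj_id nat).

Definition same_state (e n : nat) (l l' : seq (nat + nat)) : Prop :=
  wact l word0 = wact l' word0 /\
  forall x, (x < n)%N -> pexp e l word0 x = pexp e l' word0 x %[mod e].

(** Descent on a bound for the sizes of the coefficients: at a = 0 their constant terms vanish, so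
    all are divisible by ['X]. *)
Lemma gprod_free (e n : nat) (ls : seq (seq (nat + nat))) :
  (2 <= n)%N -> (0 < e)%N -> all (all (gvalid e n)) ls -> uniq ls ->
  {in ls &, forall l l', same_state e n l l' -> l = l'} ->
  forall k : 'I_(size ls) -> {poly int},
    \sum_i k i *: gprod e n (nth [::] ls i) = 0 -> forall i, k i = 0.
Proof.
move=> n2 e0 ls_valid ls_uniq ls_inj.
have [z z_prim] := C_prim_root_exists e0.
pose c (q : {ffun 'I_n -> 'I_e}) x : nat :=
  if insub x is Some i then q i else 0%N.
have c_lt q x : (c q x < e)%N by rewrite /c; case: insub.
have c_supp q x : (n <= x)%N -> c q x = 0%N.
  by move=> nx; rewrite /c insubF // ltnNge nx.
have cE q (x : 'I_n) : c q x = q x by rewrite /c valK.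
have valid i : (i < size ls)%N -> all (gvalid e n) (nth [::] ls i).
  by move=> i_ls; apply: (allP ls_valid); apply: mem_nth.
move=> k k0.
(* From here on only the action of the relation is kept: it takes values in a domain, where ['X] can
   be cancelled. *)
have {k0} : forall q f, \sum_i scal (k i) *
    hact z (c q) (gprod e n (nth [::] ls i)) f word0 = 0.
  by move=> q f; rewrite -(hact_sum n2 z_prim (c_lt q)) k0 (hact0 n2 z_prim).
have : forall i, (size (k i) <= \max_i size (k i))%N.
  by move=> i; apply: (leq_bigmax i).
move: (\max_i size (k i)) => N; elim: N k => [|N IH] k kN k0 i.
  by apply/eqP; rewrite -size_poly_eq0 -leqn0.
have k_at0 (j : 'I_(size ls)) : (k j)`_0 = 0.
  suff : ((k j)`_0)%:~R = 0 :> algC by move/eqP; rewrite intr_eq0 => /eqP.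
  move: j; apply: (monomial_independence (n := n) e0 z_prim
    (p := fun i => pexp e (nth [::] ls i) word0)
    (w := fun i => wact (nth [::] ls i) word0)) => [j1 j2 wij pij | q f].
    apply/val_inj/eqP.
    rewrite -(nth_uniq [::] (ltn_ord j1) (ltn_ord j2) ls_uniq); apply/eqP.
    apply: ls_inj; rewrite ?mem_nth //; split=> // x xn.
    exact: (pij (Ordinal xn)).
  have /(congr1 (fun p : {poly algC} => p.[0])) := k0 q (fun v => (f v)%:P).
  rewrite horner_sum horner0 => h0; rewrite -[RHS]h0; apply: eq_bigr => m _.
  rewrite hornerM gprod_at0 ?valid //; last exact: c_supp.
  rewrite hornerC /scal horner_coef0 coef_map /=.
  by under eq_bigr do rewrite -cE.
have kE (j : 'I_(size ls)) : k j = drop_poly 1 (k j) * 'X.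
  rewrite -{1}(poly_take_drop 1 (k j)) expr1.
  rewrite [take_poly _ _](_ : _ = 0) ?add0r //.
  by apply/polyP => [[|m]]; rewrite coef_take_poly coef0 //= k_at0.
rewrite kE (IH (fun j => drop_poly 1 (k j))) ?mul0r // => [j | q f].
  by rewrite size_drop_poly leq_subLR add1n.
have /eqP := k0 q f.
under eq_bigr do rewrite kE /scal rmorphM /= map_polyX [_ * 'X]mulrC -mulrA.
by rewrite -mulr_sumr mulf_eq0 polyX_eq0 /= => /eqP.
Qed.

(** * Normal words *)

Lemma index_iotaSr i j : (j <= i)%N ->
  index_iota j i.+1 = rcons (index_iota j i) i.
Proof.
by move=> ji; rewrite /index_iota subSn // -addn1 iotaD cats1 /= subnKC.
Qed.

Lemma index_iota_nil i j : (i <= j)%N -> index_iota j i = [::].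
Proof. by rewrite /index_iota -subn_eq0 => /eqP->. Qed.

Section NormalWords.

Variable e : nat.
Hypothesis e_gt0 : (0 < e)%N.

Local Notation gen := (nat + nat)%type.
Implicit Types (l y : seq gen) (g : gen).

Definition gdown i j : seq gen := [seq inr k | k <- rev (index_iota j i.+1)].

Definition gup i j : seq gen := [seq inr k | k <- index_iota i j.+1].

(** This also covers [i = 2]: [gdown 2 3] is empty and [gup 2 2] is the single letter [inr 2], that
    is $t_0$. *)
Definition nwords_ i : seq (seq gen) :=
  [:: [::]] ++ [seq gdown i j | j <- index_iota 3 i.+1]
    ++ [seq gdown i 3 ++ [:: inl k] | k <- index_iota 0 e]
    ++ [seq (gdown i 3 ++ [:: inl k]) ++ gup 2 j
         | k <- index_iota 1 e, j <- index_iota 2 i.+1].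

Definition nwords (s : seq nat) : seq (seq gen) :=
  foldl (fun L i => [seq x ++ y | x <- L, y <- nwords_ i]) [:: [::]] s.

Definition gpos g : nat := if g is inr j then (j - 2)%N else 0%N.

(** The final position of the letter that starts at [p], whatever the word is ([wact_track]);
    [track_exp] is the exponent this letter collects ([pexp_track]). *)
Definition track l p : nat := foldl (fun p g => swapn (gpos g) p) p l.

Definition gtrack g p : nat :=
  if g is inl k then (k * e.-1 * (p == 0) + k * (p == 1))%N else 0%N.

Fixpoint track_exp l p : nat :=
  if l is g :: l' then (gtrack g p + track_exp l' (swapn (gpos g) p))%N
  else 0%N.

Lemma track_cat l l' p : track (l ++ l') p = track l' (track l p).
Proof. exact: foldl_cat. Qed.

Lemma track_exp_cat l l' p :
  track_exp (l ++ l') p = (track_exp l p + track_exp l' (track l p))%N.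
Proof. by elim: l p => //= g l IH p; rewrite IH addnA. Qed.

Lemma wact_track l w p : wact l w (track l p) = w p.
Proof.
elim: l w p => //= g l IH w p; rewrite -/(wact l _) -/(track l _) IH.
by rewrite /gswap /gpos /swap /= swapnK.
Qed.

Lemma pexp_track l w p : pexp e l w (w p) = track_exp l p.
Proof.
elim: l w p => //= g l IH w p; congr (_ + _)%N; last first.
  by rewrite -(IH (gswap g w)) /gswap /gpos /swap /= swapnK.
by case: g => //= k; rewrite !(inj_eq (@word_inj w)).
Qed.

Lemma wact_cat l l' w : wact (l ++ l') w = wact l' (wact l w).
Proof. exact: foldl_cat. Qed.

Lemma pexp_cat l l' w x :
  pexp e (l ++ l') w x = (pexp e l w x + pexp e l' (wact l w) x)%N.
Proof. by elim: l w => //= g l IH w; rewrite IH addnA. Qed.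

Lemma wact_inj l : injective (wact l).
Proof.
by elim: l => //= g l IH v w /IH /(can_inj (swapK _)).
Qed.

Definition below m g :=
  match g with inl k => (2 <= m)%N && (k < e)%N | inr j => (2 <= j <= m)%N end.

Lemma track_above m l p : all (below m) l -> (m <= p)%N ->
  track l p = p /\ track_exp l p = 0%N.
Proof.
move=> + mp; elim: l => //= g l IH /andP[gm /IH[IH1 IH2]].
have -> : swapn (gpos g) p = p by case: g gm => /= *; apply: swapn_out; lia.
rewrite IH2 addn0; split=> //; case: g gm => //= k /andP[m2 _].
by rewrite !gtn_eqF ?muln0 //; lia.
Qed.

Lemma track_exp_inr (s : seq nat) p : track_exp [seq inr k | k <- s] p = 0%N.
Proof. by elim: s p => //= j s IH p; rewrite IH. Qed.

Lemma gdownS i j : (j <= i.+1)%N -> gdown i.+1 j = inr i.+1 :: gdown i j.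
Proof. by move=> ji; rewrite /gdown index_iotaSr // rev_rcons. Qed.

Lemma gdown_nil i j : (i < j)%N -> gdown i j = [::].
Proof. by move=> ij; rewrite /gdown index_iota_nil. Qed.

Lemma gupS i j : (i <= j.+1)%N -> gup i j.+1 = rcons (gup i j) (inr j.+1).
Proof. by move=> ij; rewrite /gup index_iotaSr // map_rcons. Qed.

Lemma track_down i j : (2 <= j <= i.+1)%N -> track (gdown i j) i.-1 = (j - 2)%N.
Proof.
elim: i => [|i IH] ji; first lia.
have [->|nji] := eqVneq j i.+2; first by rewrite gdown_nil //= subn2.
rewrite gdownS; last lia.
have -> : i.+1.-1 = (i.+1 - 2).+1 by lia.
by rewrite /= swapnr -/(track _ _) (_ : (i.+1 - 2)%N = i.-1) ?IH //; lia.
Qed.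

Lemma track_up j : (0 < j)%N -> track (gup 2 j) 0 = j.-1.
Proof.
case: j => // j _; elim: j => // j IH.
rewrite gupS // -cats1 track_cat IH /= subn2 /=.
by rewrite swapnl.
Qed.

Definition nword_key i y := (track y i.-1, track_exp y i.-1).

(** The letter at position [i.-1] descends along [gdown]; after a full descent to position 1, t_k
    moves it to position 0 with exponent [k], and [gup 2 j] raises it to [j.-1]. Each pair of a
    position below [i] and an exponent below [e] occurs once. *)
Lemma nwords_keys i : (2 <= i)%N -> map (nword_key i) (nwords_ i) =
  [:: (i.-1, 0%N)] ++ [seq ((j - 2)%N, 0%N) | j <- index_iota 3 i.+1]
    ++ [seq (0%N, k) | k <- index_iota 0 e]
    ++ [seq (j.-1, k) | k <- index_iota 1 e, j <- index_iota 2 i.+1].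
Proof.
move=> i2; rewrite !map_cat /= -!map_comp map_allpairs.
have exp_down j p : track_exp (gdown i j) p = 0%N by apply: track_exp_inr.
have down3 : track (gdown i 3) i.-1 = 1%N by rewrite track_down //; lia.
congr (_ :: _ ++ (_ ++ _)).
- apply/eq_in_map => j; rewrite mem_index_iota => ji /=.
  by rewrite /nword_key exp_down track_down //; lia.
- apply/eq_map => k /=; rewrite /nword_key track_cat track_exp_cat exp_down.
  by rewrite down3 /= addn0 muln1 muln0.
- apply/eq_in_allpairs => k j _; rewrite mem_index_iota => ji.
  rewrite /nword_key !track_cat !track_exp_cat exp_down down3 /= track_exp_inr.
  by rewrite swapnr track_up ?muln0 ?muln1 ?addn0 //; lia.
Qed.

Lemma nwords_keys_uniq i : (2 <= i)%N -> uniq (map (nword_key i) (nwords_ i)).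
Proof.
move=> i2; rewrite nwords_keys // cat1s cons_uniq; apply/andP; split.
  rewrite !mem_cat !negb_or; apply/and3P; split; apply/negP.
  - by case/mapP => j; rewrite mem_index_iota => ji []; lia.
  - by case/mapP => k _ [] /eqP; rewrite -subn1; lia.
  - by case/allpairsP => -[k j] /= []; rewrite !mem_index_iota => ? ? []; lia.
rewrite !cat_uniq; apply/and3P; split.
- rewrite map_inj_in_uniq ?iota_uniq // => j j'; rewrite !mem_index_iota.
  by move=> ? ? []; lia.
- apply/hasPn => q; rewrite mem_cat => /orP[/mapP|/allpairsP] [].
    move=> k _ ->; apply/negP => /mapP[j]; rewrite mem_index_iota => ? [].
    by lia.
  move=> [k j] /= []; rewrite !mem_index_iota => ? _ ->.
  apply/negP => /mapP[j' _].
  by case=> _; lia.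
apply/and3P; split.
- by rewrite map_inj_uniq ?iota_uniq // => k k' [].
- apply/hasPn => q /allpairsP[[k j]] /= []; rewrite !mem_index_iota => _ ? ->.
  by apply/negP => /mapP[k' _ []]; lia.
- apply: allpairs_uniq; rewrite ?iota_uniq // => -[k j] [k' j'].
  move=> /allpairsP[[k1 j1]] /= [_ + [-> ->]].
  move=> + /allpairsP[[k2 j2]] /= [_ + [-> ->]].
  by rewrite !mem_index_iota => ? ? [? ->]; congr pair; lia.
Qed.

Lemma nwords_exp_lt i y : (2 <= i)%N -> y \in nwords_ i ->
  (track_exp y i.-1 < e)%N.
Proof.
move=> i2 yi; have := map_f (nword_key i) yi; rewrite nwords_keys // !mem_cat.
rewrite inE; case/or4P; first by move/eqP => [_ ->].
- by case/mapP => j _ [_ ->].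
- by case/mapP => k; rewrite mem_index_iota => ? [_ ->].
- by case/allpairsP => -[k j] /= []; rewrite mem_index_iota => ? _ [_ ->]; lia.
Qed.

Lemma uniq_map_inj (T U : eqType) (f : T -> U) (s : seq T) :
  uniq (map f s) -> {in s &, injective f}.
Proof.
elim: s => //= a s IH /andP[fa /IH {}IH] u v; rewrite !inE.
move=> /predU1P[->|us] /predU1P[->|vs] // fE; last exact: IH.
- by rewrite fE map_f in fa.
- by rewrite -fE map_f in fa.
Qed.

Lemma nwords_below i y : (2 <= i)%N -> y \in nwords_ i -> all (below i) y.
Proof.
move=> i2; have down j : (2 <= j)%N -> all (below i) (gdown i j).
  move=> j2; apply/allP => g /mapP[k].
  by rewrite mem_rev mem_index_iota => ? -> /=; lia.
rewrite !mem_cat inE; case/or4P => [/eqP-> //|/mapP|/mapP|/allpairsP] [].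
- by move=> j; rewrite mem_index_iota => ? ->; apply: down; lia.
- by move=> k; rewrite mem_index_iota => ke ->; rewrite all_cat /= down ?i2 ?ke.
- move=> [k j] /= []; rewrite !mem_index_iota => /andP[_ ke] ji ->.
  rewrite !all_cat /= down // i2 ke /=; apply/allP => g /mapP[m].
  by rewrite mem_index_iota => ? -> /=; lia.
Qed.

(* The last factor [y] of [x ++ y] is determined by the final position and    *)
(* exponent of the letter [m.-1], which [x] does not move.                    *)
Lemma nwords_inj n m : (0 < m <= n)%N ->
  let L := nwords (index_iota 2 m.+1) in
  [/\ {in L, forall l, all (below m) l}, uniq L
     & {in L &, forall l l', same_state e n l l' -> l = l'}].
Proof.
case: m => // m; elim: m => [|m IH] mn.
  by rewrite /nwords /=; split=> //= l; [rewrite inE => /eqP-> | move=> l';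
    rewrite !inE => /eqP-> /eqP->].
have {IH}[below_L uniq_L inj_L] := IH (ltnW mn).
rewrite /nwords index_iotaSr // foldl_rcons -/(nwords _).
set L := nwords _ in below_L uniq_L inj_L *.
have inj : {in L & nwords_ m.+2, forall l1 y1, {in L & nwords_ m.+2,
    forall l2 y2, same_state e n (l1 ++ y1) (l2 ++ y2) -> l1 = l2 /\ y1 = y2}}.
  move=> l1 y1 l1L y1m l2 y2 l2L y2m [/[!wact_cat] wE pE].
  have [t1 x1] := track_above (below_L _ l1L) (leqnn _).
  have [t2 x2] := track_above (below_L _ l2L) (leqnn _).
  have w1 : wact l1 word0 m.+1 = m.+1.
    by rewrite -[X in wact _ _ X]t1 wact_track.
  have w2 : wact l2 word0 m.+1 = m.+1.
    by rewrite -[X in wact _ _ X]t2 wact_track.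
  have y12 : y1 = y2.
    apply: (uniq_map_inj (nwords_keys_uniq (isT : 1 < m.+2)%N)) => //.
    rewrite /nword_key /=; congr pair.
      apply: (@word_inj (wact y1 (wact l1 word0))).
      by rewrite [in RHS]wE !wact_track w1 w2.
    have := pE m.+1 mn; rewrite !pexp_cat.
    rewrite [pexp e l1 _ _](pexp_track l1 word0 m.+1) x1 add0n.
    rewrite [pexp e l2 _ _](pexp_track l2 word0 m.+1) x2 add0n.
    have -> : pexp e y1 (wact l1 word0) m.+1 = track_exp y1 m.+1.
      by rewrite -[X in pexp _ _ _ X]w1 pexp_track.
    have -> : pexp e y2 (wact l2 word0) m.+1 = track_exp y2 m.+1.
      by rewrite -[X in pexp _ _ _ X]w2 pexp_track.
    by rewrite !modn_small //; apply: (@nwords_exp_lt m.+2).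
  split=> //; apply: inj_L => //; rewrite -y12 in wE pE.
  move/wact_inj: wE => wE; split=> // x xn.
  by have /eqP := pE x xn; rewrite !pexp_cat wE eqn_modDr => /eqP.
split=> [l /allpairsP[[x y] /= [xL ym ->]]||].
- rewrite all_cat (nwords_below _ ym) // andbT.
  by apply: sub_all (below_L x xL) => -[k|j] //=; lia.
- apply: allpairs_uniq => //; first exact: map_uniq (nwords_keys_uniq _).
  move=> _ _ /allpairsP[p [xL yL ->]] /allpairsP[q [xL' yL' ->]] pq.
  have [|-> ->] // := inj _ _ xL yL _ _ xL' yL'.
  by rewrite (pq : p.1 ++ p.2 = q.1 ++ q.2).
- move=> l l' /allpairsP[p [xL ym ->]] /allpairsP[q [xL' ym' ->]].
  by move=> /(inj _ _ xL ym _ _ xL' ym')[-> ->].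
Qed.

End NormalWords.

(** * Spanning *)

Section LinearSpan.

Variables (R : comNzRingType) (V : lmodType R).
Implicit Types (b : seq V) (N : V -> Prop).

Definition submodule N := N 0 /\ forall k x y, N x -> N y -> N (k *: x + y).

Definition lspan b (v : V) :=
  exists c : 'I_(size b) -> R, v = \sum_i c i *: b`_i.

Lemma lspan_submodule b : submodule (lspan b).
Proof.
split=> [|k _ _ [c ->] [d ->]].
  by exists (fun=> 0); rewrite big1 // => i _; rewrite scale0r.
exists (fun i => k * c i + d i); rewrite scaler_sumr -big_split.
by apply: eq_bigr => i _; rewrite scalerDl scalerA.
Qed.

Lemma submoduleD N x y : submodule N -> N x -> N y -> N (x + y).
Proof. by case=> _ NP Nx Ny; rewrite -[x]scale1r; apply: NP. Qed.

Lemma submoduleZ N k x : submodule N -> N x -> N (k *: x).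
Proof. by case=> N0 NP Nx; rewrite -[_ *: _]addr0; apply: NP. Qed.

Lemma submoduleB N x y : submodule N -> N x -> N y -> N (x - y).
Proof.
move=> NP Nx Ny; apply: submoduleD => //.
by rewrite -scaleN1r; apply: submoduleZ.
Qed.

Lemma lspan_mem b v : v \in b -> lspan b v.
Proof.
move=> /(nthP 0)[i ib <-]; exists (fun j => (j == Ordinal ib)%:R).
rewrite (bigD1 (Ordinal ib)) //= eqxx scale1r big1 ?addr0 // => j /negbTE->.
by rewrite scale0r.
Qed.

Lemma lspan_ind b N v :
  submodule N -> {in b, forall x, N x} -> lspan b v -> N v.
Proof.
move=> NP bN [c ->]; elim/big_rec: _ => [|i x _ Nx]; first by case: NP.
by case: NP => _; apply=> //; apply: bN; apply: mem_nth.
Qed.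

End LinearSpan.

Section Spanning.

Variables e n : nat.
Hypothesis e_gt0 : (0 < e)%N.

Local Notation H := (hecke e n).
Local Notation s := (sgen e n).
Local Notation D := (s_down e n).
Local Notation U := (s_up e n).
Local Notation a := ('X : {poly int}).

(** Indices are extended periodically, so that index shifts need no wrap-around case. *)
Definition tmod k : H := tgen e n (k %% e).

Local Notation t := tmod.

Lemma t_class k (ke : (k %% e < e)%N) :
  t k = presclass _ (EVar (GT n (Ordinal ke))).
Proof.
rewrite /tmod /tgen insubT.
by congr (presclass _ (EVar (GT n _))); apply: val_inj.
Qed.

Lemma t_small k : (k < e)%N -> tgen e n k = t k.
Proof. by move=> ke; rewrite /tmod modn_small. Qed.

Lemma s2E : s 2 = t 0.
Proof. by rewrite /sgen eqxx /tmod mod0n. Qed.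

Lemma s_class j (jn : (3 <= j <= n)%N) :
  s j = presclass _ (EVar (GS e (exist _ j jn : sidx n))).
Proof.
rewrite /sgen gtn_eqF ?insubT; last by case/andP: jn.
by congr (presclass _ (EVar (GS e _))); apply: val_inj.
Qed.

Let presrel x y : hecke_rel x y ->
  presclass (@hecke_rel e n) x = presclass _ y.
Proof. by move=> xy; apply/presclassP/pc_rel. Qed.

Let te k : (k %% e < e)%N := ltn_pmod k e_gt0.

Lemma t_rot k l : t k.+1 * t k = t l.+1 * t l.
Proof.
have predE i : ord_pred (Ordinal (te i.+1)) = Ordinal (te i).
  apply: val_inj => /=.
  rewrite (_ : (i.+1 %% e + e).-1 = (i.+1 %% e + e.-1)%N); last lia.
  by rewrite modnDml addSnnS prednK // modnDr.
have /presrel := hr_tt n (Ordinal (te k.+1)) (Ordinal (te l.+1)).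
by rewrite !presclassM !predE -!t_class.
Qed.

Lemma t_quad k : t k * t k = a *: t k + 1.
Proof.
have /presrel := hr_quad_t n (Ordinal (te k)).
rewrite !(presclassD, presclassN, presclassM, presclassZ).
rewrite presclass1 presclass0.
by rewrite -!t_class -addrA -opprD => /eqP; rewrite subr_eq0 => /eqP.
Qed.

Lemma s_quad j : (2 <= j <= n)%N -> s j * s j = a *: s j + 1.
Proof.
have [->|j2] := eqVneq j 2; first by rewrite s2E t_quad.
move=> jn; have j3 : (3 <= j <= n)%N by lia.
have /presrel := hr_quad_s e (exist _ j j3 : sidx n).
rewrite !(presclassD, presclassN, presclassM, presclassZ).
rewrite presclass1 presclass0.
by rewrite -!s_class -addrA -opprD => /eqP; rewrite subr_eq0 => /eqP.
Qed.

Lemma ts_braid k : (3 <= n)%N -> t k * s 3 * t k = s 3 * t k * s 3.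
Proof.
move=> n3; have j3 : (3 <= 3 <= n)%N by [].
have /presrel := @hr_t_s3 e n (Ordinal (te k)) (exist _ 3 j3) erefl.
by rewrite !presclassM -!t_class -!s_class.
Qed.

Lemma st_comm k j : (4 <= j <= n)%N -> s j * t k = t k * s j.
Proof.
move=> /andP[j4 jn]; have j3 : (3 <= j <= n)%N by lia.
have /presrel := @hr_s_t e n (Ordinal (te k)) (exist _ j j3) j4.
by rewrite !presclassM -!t_class -!s_class.
Qed.

Lemma s_braid j : (2 <= j < n)%N -> s j * s j.+1 * s j = s j.+1 * s j * s j.+1.
Proof.
have [->|j2] := eqVneq j 2; first by rewrite s2E => ?; apply: ts_braid.
move=> jn; have [j3 j4] : (3 <= j <= n)%N /\ (3 <= j.+1 <= n)%N by lia.
have /presrel := @hr_braid e n (exist _ j j3) (exist _ j.+1 j4) erefl.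
by rewrite !presclassM -!s_class.
Qed.

Lemma s_comm i j : (2 <= i <= n)%N -> (2 <= j <= n)%N -> (i.+1 < j)%N ->
  s i * s j = s j * s i.
Proof.
have [->|i2] := eqVneq i 2.
  by rewrite s2E => _ jn j3; rewrite st_comm //; lia.
move=> i_n jn ij; have [i3 j3] : (3 <= i <= n)%N /\ (3 <= j <= n)%N by lia.
have ij1 : (i + 1 < j)%N || (j + 1 < i)%N by rewrite addn1 ij.
have /presrel := @hr_comm e n (exist _ i i3) (exist _ j j3) ij1.
by rewrite !presclassM -!s_class.
Qed.

Lemma t_inj k : injective ( *%R (t k)).
Proof.
have tE x : x = t k * (t k * x) - a *: (t k * x).
  by rewrite mulrA t_quad mulrDl mul1r scalerAl addrAC subrr add0r.
by move=> x y xy; rewrite (tE x) (tE y) xy.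
Qed.

(** Multiply on the left by the invertible [t k.+1]; both sides reduce by [t_rot] and [t_quad]. *)
Lemma t_shift k l :
  t k * t l = t k.+1 * t l.+1 + (a *: t k - a *: t l.+1).
Proof.
apply: (@t_inj k.+1); rewrite mulrA (t_rot k l) -mulrA t_quad.
rewrite mulrDr mulr1 -scalerAr mulrDr mulrBr -!scalerAr mulrA t_quad.
rewrite mulrDl mul1r -scalerAl (t_rot k l).
by rewrite [RHS]addrC [RHS]addrA subrK.
Qed.

(* Shifting both indices of [t k * t p] brings the second one to [l].         *)
Lemma dihedral_span (N : H -> Prop) l : submodule N -> N 1 ->
  (forall q, N (t q)) -> (forall q, N (t q * t l)) -> forall k p, N (t k * t p).
Proof.
move=> NP N1 Nt Ntt k p.
suff Nm m q r : N (t (q + m) * t (r + m)) -> N (t q * t r).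
  (* This number of shifts sends [p] to [l + p * e], which is [l] modulo [e]. *)
  apply: (Nm (l + p * e.-1)%N); rewrite [(p + _)%N]addnCA -mulnS prednK //.
  by rewrite (_ : t (l + p * e) = t l) // /tmod addnC modnMDl.
elim: m q r => [|m IH] q r; first by rewrite !addn0.
rewrite -![(_ + m.+1)%N]addSnnS => /IH Nqr; rewrite t_shift.
by apply: submoduleD => //; apply: submoduleB => //; apply: submoduleZ.
Qed.

Lemma s_down_nil i j : (i < j)%N -> D i j = 1.
Proof. by move=> ij; rewrite /s_down index_iota_nil // big_nil. Qed.

Lemma s_downS i j : (j <= i.+1)%N -> D i.+1 j = s i.+1 * D i j.
Proof. by move=> ji; rewrite /s_down index_iotaSr // rev_rcons big_cons. Qed.

Lemma s_down_recr i j : (j <= i)%N -> D i j = D i j.+1 * s j.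
Proof.
move=> ji; rewrite /s_down /index_iota subSn // subSS /= rev_cons -cats1.
by rewrite big_cat big_seq1.
Qed.

Lemma s_upS i j : (i <= j.+1)%N -> U i j.+1 = U i j * s j.+1.
Proof. by move=> ij; rewrite /s_up index_iotaSr // -cats1 big_cat big_seq1. Qed.

Lemma s_up_nil i j : (j < i)%N -> U i j = 1.
Proof. by move=> ij; rewrite /s_up index_iota_nil // big_nil. Qed.

Lemma s_down_comm i j m : (2 <= i)%N -> (2 <= j <= n)%N -> (m <= n)%N ->
  (j.+1 < i)%N || (m.+1 < j)%N -> D m i * s j = s j * D m i.
Proof.
move=> i2 jn; elim: m => [|m IH] mn ij.
  by rewrite s_down_nil ?mul1r ?mulr1 //; lia.
have [mi|im] := ltnP m.+1 i; first by rewrite s_down_nil // mul1r mulr1.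
rewrite s_downS // -mulrA IH; [|lia..].
rewrite !mulrA; congr (_ * _).
by case/orP: ij => ij; [rewrite [RHS]s_comm // | rewrite s_comm //]; lia.
Qed.

Lemma s_down_braid i j m : (2 <= i < j)%N -> (j <= m <= n)%N ->
  D m i * s j = s j.-1 * D m i.
Proof.
case: j => [|j] ij; first lia.
elim: m => [|m IH] jm; first lia.
rewrite s_downS; last lia.
have [mj|mj] := eqVneq m j; last first.
  rewrite -mulrA IH; last lia.
  by rewrite !mulrA /= [s j * s m.+1]s_comm //; lia.
case: m => [|m] in IH jm mj *; first lia.
rewrite s_downS -?mj; last lia.
rewrite -!mulrA s_down_comm; [|lia..].
by rewrite !mulrA s_braid //; lia.
Qed.

Lemma s_down_t i m k : (4 <= i)%N -> (m <= n)%N -> D m i * t k = t k * D m i.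
Proof.
move=> i4; elim: m => [|m IH] mn.
  by rewrite s_down_nil ?mul1r ?mulr1 //; lia.
have [mi|im] := ltnP m.+1 i; first by rewrite s_down_nil // mul1r mulr1.
by rewrite s_downS // -mulrA IH ?(ltnW mn) // !mulrA st_comm //; lia.
Qed.

Lemma s_up_comm i j : (j.+1 < i <= n)%N -> U 2 j * s i = s i * U 2 j.
Proof.
elim: j => [|j IH] ij; first by rewrite s_up_nil // mul1r mulr1.
have [j1|j1] := ltnP j.+1 2; first by rewrite s_up_nil // mul1r mulr1.
by rewrite s_upS // -mulrA s_comm ?mulrA ?IH //; lia.
Qed.

Lemma s_up_braid i j : (2 <= i < j)%N -> (j <= n)%N ->
  U 2 j * s i = s i.+1 * U 2 j.
Proof.
elim: j => [|j IH] ij jn; first lia.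
rewrite s_upS; last lia.
have [ji|ji] := eqVneq j i; last first.
  by rewrite -mulrA -s_comm ?mulrA ?IH //; lia.
case: j => [|j] in IH ij jn ji *; first lia.
rewrite -{i}ji in ij IH *; rewrite s_upS; last lia.
rewrite -2!mulrA [s j.+1 * _]mulrA s_braid; last lia.
by rewrite !mulrA s_up_comm //; lia.
Qed.

Definition gen_stable m (N : H -> Prop) :=
  (forall k x, N x -> N (x * t k)) /\
  (forall j x, (3 <= j <= m)%N -> N x -> N (x * s j)).

Section InductionStep.

Variables (m : nat) (L : seq H).
Hypotheses (m3 : (3 <= m)%N) (mn : (m <= n)%N).
Hypothesis L_stable : gen_stable m.-1 (lspan L).

Local Notation M := (lspan [seq x * y | x <- L, y <- Lambda_ge3 e n m]).
(** Left factors that stabilize the span of [L], namely every [t k] and [s j] with [j < m], can be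
    absorbed in front of [v] ([quot_t], [quot_s]). Rewriting therefore aims at moving such factors
    to the left of [D m 3]. *)
Let Q (v : H) := forall x, lspan L x -> M (x * v).

Lemma quot_submodule : submodule Q.
Proof.
have [M0 MP] := lspan_submodule [seq x * y | x <- L, y <- Lambda_ge3 e n m].
split=> [x _|k u v Qu Qv x Lx]; first by rewrite mulr0.
by rewrite mulrDr -scalerAr; apply: MP; [apply: Qu | apply: Qv].
Qed.

Let QD u v : Q u -> Q v -> Q (u + v).
Proof. exact: submoduleD quot_submodule. Qed.

Let QZ k v : Q v -> Q (k *: v).
Proof. exact: submoduleZ quot_submodule. Qed.

Lemma quot_mem y : y \in Lambda_ge3 e n m -> Q y.
Proof.
move=> ym x; apply: (lspan_ind (N := fun x => M (x * y))) => [|z zL].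
  have [M0 MP] := lspan_submodule [seq x * y | x <- L, y <- Lambda_ge3 e n m].
  split=> [|k u v Mu Mv]; first by rewrite mul0r.
  by rewrite mulrDl -scalerAl; apply: MP.
by apply: lspan_mem; apply: allpairs_f.
Qed.

Lemma quot_t k v : Q v -> Q (t k * v).
Proof.
by move=> Qv x Lx; rewrite mulrA; apply: Qv; case: L_stable => + _; apply.
Qed.

Lemma quot_s j v : (3 <= j < m)%N -> Q v -> Q (s j * v).
Proof.
move=> jm Qv x Lx; rewrite mulrA; apply: Qv; case: L_stable => _; apply=> //.
by lia.
Qed.

Lemma quot_1 : Q 1.
Proof. by apply: quot_mem; rewrite mem_head. Qed.

Lemma quot_down j : (3 <= j)%N -> Q (D m j).
Proof.
move=> j3; have [mj|jm] := ltnP m j.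
  by rewrite s_down_nil //; apply: quot_1.
apply: quot_mem; rewrite !mem_cat; apply/or4P/Or42.
by apply: map_f; rewrite mem_index_iota j3.
Qed.

Lemma quot_downt k : Q (D m 3 * t k).
Proof.
apply: quot_mem; rewrite !mem_cat; apply/or4P/Or43.
by apply/mapP; exists (k %% e)%N => //; rewrite mem_index_iota te.
Qed.

(** For [j = 3] the braid relation between [t k] and [s 3] gives [h = t k]; for larger [j] the
    generator passes to the left as [s j.-1]. *)
Lemma downt_s k j : (3 <= j <= m)%N ->
  exists2 h, D m 3 * t k * s j = h * (D m 3 * t k) & forall v, Q v -> Q (h * v).
Proof.
move=> jm; have [->|j3] := eqVneq j 3.
  exists (t k); last exact: quot_t.
  rewrite s_down_recr // -!mulrA [s 3 * _]mulrA -ts_braid; last lia.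
  by rewrite !mulrA s_down_t.
exists (s j.-1); last by move=> v; apply: quot_s; lia.
by rewrite -mulrA -st_comm ?mulrA ?s_down_braid //; lia.
Qed.

(** The trailing [v] lets [quot_down_prod] absorb a product of generators one at a time. *)
Lemma down_s i j v : (3 <= i <= m.+1)%N -> (3 <= j <= m)%N ->
  (forall i', (3 <= i' <= m.+1)%N -> Q (D m i' * v)) -> Q (D m i * s j * v).
Proof.
move=> i3 jm Qv; case: (ltngtP j i) => ij.
- have [->|ji] := eqVneq i j.+1.
    by rewrite -s_down_recr; [apply: Qv|]; lia.
  rewrite s_down_comm -?mulrA; [|lia..].
  by apply: quot_s; [lia | apply: Qv].
- rewrite s_down_braid -?mulrA; [|lia..].
  by apply: quot_s; [lia | apply: Qv].
- rewrite ij s_down_recr; last lia.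
  rewrite -[_ * s i * s i]mulrA s_quad; last lia.
  rewrite mulrDr mulr1 -scalerAr -s_down_recr; last lia.
  rewrite mulrDl -scalerAl.
  by apply: QD; [apply: QZ|]; apply: Qv; lia.
Qed.

Lemma quot_down_prod (r : seq nat) i k : {in r, forall j, 3 <= j <= m}%N ->
  (3 <= i <= m.+1)%N ->
  Q (D m i * \prod_(j <- r) s j) /\ Q (D m 3 * t k * \prod_(j <- r) s j).
Proof.
elim: r i => [|j r IH] i rm i3.
  by rewrite big_nil !mulr1; split; [apply: quot_down; lia | apply: quot_downt].
have jm : (3 <= j <= m)%N by apply: rm; rewrite mem_head.
have {}IH i' := IH i' (fun j' jr => rm j' (mem_behead (s := j :: r) jr)).
rewrite big_cons !mulrA; split; first by apply: down_s => // i' /IH[].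
have [h -> Qh] := downt_s k jm; rewrite -mulrA; apply: Qh.
by have [|_ +] := IH 3; first lia.
Qed.

Lemma quot_downtup k j : (2 <= j <= m)%N -> Q (D m 3 * t k * U 2 j).
Proof.
(* For [k] divisible by [e] the product is not listed in [Lambda_ge3]; there [t 0 * s 2] is the
   square of [t 0], and the quadratic relation applies. *)
move=> jm; have [k0|k0] := posnP (k %% e); last first.
  apply: quot_mem; rewrite !mem_cat; apply/or4P/Or44.
  by apply/allpairsP; exists (k %% e, j)%N; rewrite /= !mem_index_iota k0 te.
have -> : U 2 j = t 0 * \prod_(i <- index_iota 3 j.+1) s i.
  by rewrite -s2E /s_up big_ltn; [|lia].
have -> : t k = t 0 by rewrite /tmod k0 mod0n.
rewrite mulrA -[_ * t 0 * t 0]mulrA t_quad mulrDr mulr1 mulrDl.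
rewrite -!(scalerAr, scalerAl).
have [||Q1 Q2] := @quot_down_prod (index_iota 3 j.+1) 3 0; last 1 first.
- by apply: QD => //; apply: QZ.
- by move=> i; rewrite mem_index_iota; lia.
- by lia.
Qed.

Lemma downtup_s k i j : (2 <= j <= m)%N -> (3 <= i <= m)%N ->
  Q (D m 3 * t k * U 2 j * s i).
Proof.
move=> jm im; case: (ltngtP i j) => ij.
- rewrite -mulrA s_up_braid ?mulrA; [|lia..].
  have [|h -> Qh] := @downt_s k i.+1; first lia.
  by rewrite -mulrA; apply/Qh/quot_downtup.
- have [ji|ji] := eqVneq i j.+1.
    by rewrite ji -mulrA -s_upS; [apply: quot_downtup|]; lia.
  rewrite -mulrA s_up_comm ?mulrA; last lia.
  have [h -> Qh] := downt_s k im.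
  by rewrite -mulrA; apply/Qh/quot_downtup.
- case: j ij jm => // j ij jm; rewrite ij in im *; rewrite s_upS; last lia.
  rewrite -!mulrA s_quad; last lia.
  rewrite !mulrDr !mulr1 -!scalerAr; apply: QD; last first.
    by rewrite mulrA; apply: quot_downtup; lia.
  by apply: QZ; rewrite -s_upS ?mulrA; [apply: quot_downtup|]; lia.
Qed.

Lemma Lambda_s y j : y \in Lambda_ge3 e n m -> (3 <= j <= m)%N -> Q (y * s j).
Proof.
move=> + jm; have downs i : (3 <= i <= m.+1)%N -> Q (D m i * s j).
  move=> i3; rewrite -[_ * s j]mulr1; apply: down_s => // i' i'3.
  by rewrite mulr1; apply: quot_down; lia.
rewrite !mem_cat => /or4P[|/mapP|/mapP|/allpairsP].
- by rewrite inE => /eqP->; rewrite -(@s_down_nil m m.+1) //; apply: downs; lia.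
- by case=> i; rewrite mem_index_iota => im ->; apply: downs; lia.
- case=> k; rewrite mem_index_iota => ke ->; rewrite t_small //.
  by have [h -> Qh] := downt_s k jm; apply/Qh/quot_downt.
- case=> -[k i] /= []; rewrite !mem_index_iota => ke im ->.
  by rewrite t_small; [apply: downtup_s | lia].
Qed.

(** Checking [g] on the listed factors makes both [M] and [Q] stable under right multiplication by
    [g]. *)
Lemma quot_right g : (forall y, y \in Lambda_ge3 e n m -> Q (y * g)) ->
  (forall x, M x -> M (x * g)) /\ forall v, Q v -> Q (v * g).
Proof.
move=> Qg; have Mg x : M x -> M (x * g).
  apply: (lspan_ind (N := fun x => M (x * g))).
    have [M0 MP] := lspan_submodule [seq x * y | x <- L, y <- Lambda_ge3 e n m].
    split=> [|k u v Mu Mv]; first by rewrite mul0r.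
    by rewrite mulrDl -scalerAl; apply: MP.
  move=> _ /allpairsP[p [xL ym ->]]; rewrite -mulrA; apply: Qg => //.
  exact: lspan_mem.
by split=> // v Qv x Lx; rewrite mulrA; apply/Mg/Qv.
Qed.

Lemma quot_rs v j : (3 <= j <= m)%N -> Q v -> Q (v * s j).
Proof.
by move=> jm; case: (@quot_right (s j)) => [y ym|_]; [apply: Lambda_s | apply].
Qed.

Lemma downtt k l : Q (D m 3 * (t k * t l)).
Proof.
move: k l; apply: (@dihedral_span (fun v => Q (D m 3 * v)) 0).
- split=> [|c u v Qu Qv]; first by rewrite mulr0; case: quot_submodule.
  by rewrite mulrDr -scalerAr; case: quot_submodule => _; apply.
- by rewrite mulr1; apply: quot_down.
- exact: quot_downt.
- move=> q; rewrite mulrA -s2E -[s 2]mul1r -(@s_up_nil 2 1) // -s_upS //.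
  by apply: quot_downtup; lia.
Qed.

Lemma downttt k l p : Q (D m 3 * (t k * t l * t p)).
Proof.
rewrite -mulrA; move: l p.
apply: (@dihedral_span (fun v => Q (D m 3 * (t k * v))) 0).
- split=> [|c u v Qu Qv]; first by rewrite !mulr0; case: quot_submodule.
  by rewrite !mulrDr -!scalerAr; case: quot_submodule => _; apply.
- by rewrite mulr1; apply: quot_downt.
- by move=> q; apply: downtt.
- move=> q; rewrite [t k * _]mulrA; move: k q.
  apply: (@dihedral_span (fun v => Q (D m 3 * (v * t 0))) 0).
  + split=> [|c u v Qu Qv].
      by rewrite mul0r mulr0; case: quot_submodule.
    rewrite mulrDl mulrDr -scalerAl -scalerAr.
    by case: quot_submodule => _; apply.
  + by rewrite mul1r; apply: quot_downt.
  + by move=> q; apply: downtt.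
  + move=> q; rewrite -mulrA t_quad mulrDr mulr1 -scalerAr mulrDr -scalerAr.
    by apply: QD; [apply: QZ; apply: downtt | apply: quot_downt].
Qed.

(** The delicate product. Expanding [t k * t l] in 1, [t q] and [t q * t p] puts the same [t p] on
    both sides of [s 3]. The braid relation then leaves [s 3] on the right, where [quot_rs] removes
    it, and a factor that [downt_s] carries to the left. *)
Lemma downtts k l p : Q (D m 3 * (t k * t l * s 3 * t p)).
Proof.
rewrite -[_ * s 3 * _]mulrA; move: k l.
apply: (@dihedral_span (fun v => Q (D m 3 * (v * (s 3 * t p)))) p).
- split=> [|c u v Qu Qv].
    by rewrite mul0r mulr0; case: quot_submodule.
  rewrite mulrDl mulrDr -scalerAl -scalerAr.
  by case: quot_submodule => _; apply.
- rewrite mul1r s_down_recr // -mulrA [s 3 * _]mulrA s_quad; last lia.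
  rewrite mulrDl mul1r -scalerAl mulrDr -scalerAr.
  rewrite [_ * (s 3 * _)]mulrA -s_down_recr //.
  apply: QD; first by apply/QZ/quot_downt.
  by rewrite s_down_t //; apply/quot_t/quot_down.
- move=> q; rewrite !mulrA; have [//|h -> Qh] := @downt_s q 3.
  by rewrite -!mulrA; apply/Qh/downtt.
- move=> q; rewrite -mulrA [t p * _]mulrA ts_braid; last lia.
  rewrite !mulrA; have [//|h -> Qh] := @downt_s q 3.
  rewrite -!mulrA; apply: Qh; rewrite !mulrA; apply: quot_rs; first by [].
  by rewrite -mulrA; apply: downtt.
Qed.

Lemma Lambda_t y k : y \in Lambda_ge3 e n m -> Q (y * t k).
Proof.
rewrite !mem_cat => /or4P[|/mapP|/mapP|/allpairsP].
- by rewrite inE => /eqP->; rewrite mul1r -[t k]mulr1; apply/quot_t/quot_1.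
- case=> i; rewrite mem_index_iota => im ->.
  have [->|i3] := eqVneq i 3; first exact: quot_downt.
  by rewrite s_down_t; [apply/quot_t/quot_down|..]; lia.
- case=> l; rewrite mem_index_iota => le ->; rewrite t_small // -mulrA.
  exact: downtt.
- case=> -[l i] /= []; rewrite !mem_index_iota => le im ->.
  rewrite t_small; last lia.
  have [->|i2] := eqVneq i 2.
    rewrite s_upS // s_up_nil // mul1r s2E -!mulrA [t l * _]mulrA.
    exact: downttt.
  have : (3 <= i <= m)%N by lia.
  (* For $i>3$ the factor $s_i$ commutes with [t k] and is removed on the right, which lowers the
     ascending part down to $i=3$, the case of [downtts]. *)
  move: i {im i2}; elim=> // i IH im; have [i2|i3] := eqVneq i 2.
    rewrite i2 2?s_upS // s_up_nil // mul1r s2E.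
    by rewrite -[_ * _ * t k]mulrA; move: (downtts l 0 k); rewrite !mulrA.
  rewrite s_upS; last lia.
  rewrite mulrA -[_ * s i.+1 * t k]mulrA st_comm; last lia.
  by rewrite !mulrA; apply: quot_rs => //; apply: IH; lia.
Qed.

Lemma step_stable : gen_stable m M.
Proof.
split=> [k|j x jm]; last first.
  by case: (@quot_right (s j)) => [y ym|+ _]; [apply: Lambda_s | apply].
by case: (@quot_right (t k)) => [y ym|]; [apply: Lambda_t|].
Qed.

End InductionStep.

End Spanning.

(** * The family [Lambda]: spanning and description by normal words *)

Section Lambda.

Variables e n : nat.
Hypothesis e_gt0 : (0 < e)%N.

Definition Lambda_upto m : seq (hecke e n) :=
  foldl (fun L i => [seq x * y | x <- L, y <- Lambda_ e n i]) [:: 1]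
    (index_iota 2 m.+1).

Lemma Lambda_uptoS m : (1 <= m)%N -> Lambda_upto m.+1 =
  [seq x * y | x <- Lambda_upto m, y <- Lambda_ e n m.+1].
Proof. by move=> m1; rewrite /Lambda_upto index_iotaSr // foldl_rcons. Qed.

Lemma Lambda_upto_one m : lspan (Lambda_upto m) 1.
Proof.
apply: lspan_mem; case: m => [|m]; first by rewrite /Lambda_upto mem_head.
elim: m => [|m IH]; first by rewrite /Lambda_upto mem_head.
rewrite Lambda_uptoS //; apply/allpairsP; exists (1, 1); rewrite /= mulr1.
by split=> //; rewrite /Lambda_; case: ifP => _; rewrite mem_head.
Qed.

(** Only the dihedral generators occur: [dihedral_span] with last index 0 reduces every product of
    two, and then of three, of them. *)
Lemma Lambda_two_stable : gen_stable 2 (lspan (Lambda_two e n)).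
Proof.
set B := Lambda_two e n; have BP := lspan_submodule B.
have B1 : lspan B 1 by apply: lspan_mem; rewrite mem_head.
have Bt k : lspan B (tmod e n k).
  apply: lspan_mem; rewrite !mem_cat; apply/or3P/Or32/mapP.
  by exists (k %% e)%N; rewrite // mem_index_iota ltn_pmod.
have Btt k : lspan B (tmod e n k * tmod e n 0).
  have [k0|k0] := posnP (k %% e).
    rewrite (_ : tmod e n k = tmod e n 0); last by rewrite /tmod k0 mod0n.
    by rewrite t_quad //; apply: submoduleD => //; apply: submoduleZ.
  apply: lspan_mem; rewrite !mem_cat; apply/or3P/Or33/mapP.
  exists (k %% e)%N; first by rewrite mem_index_iota k0 ltn_pmod.
  by rewrite /tmod mod0n.
have Bmul := dihedral_span e_gt0 BP B1 Bt Btt.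
split=> [k x|j x]; last by lia.
have multP g : submodule (fun v => lspan B (v * g)).
  split=> [|c u v Bu Bv]; first by rewrite mul0r; case: BP.
  by rewrite mulrDl -scalerAl; case: BP => _; apply.
apply: (lspan_ind (multP (tmod e n k))) => y.
rewrite !mem_cat => /or3P[|/mapP|/mapP] [].
- by rewrite inE => /eqP->; rewrite mul1r.
- by move=> l; rewrite mem_index_iota => le ->; rewrite t_small //; apply: Bmul.
- move=> l; rewrite mem_index_iota => le ->; rewrite !t_small //; last by lia.
  rewrite -mulrA.
  apply: (@dihedral_span _ _ e_gt0 (fun v => lspan B (tmod e n l * v)) 0).
  + split=> [|c u v Bu Bv]; first by rewrite mulr0; case: BP.
    by rewrite mulrDr -scalerAr; case: BP => _; apply.
  + by rewrite mulr1.
  + by move=> q; apply: Bmul.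
  move=> q; rewrite mulrA.
  apply: (@dihedral_span _ _ e_gt0 (fun v => lspan B (v * tmod e n 0)) 0).
  + exact: multP.
  + by rewrite mul1r.
  + exact: Btt.
  move=> p; rewrite -mulrA t_quad // mulrDr mulr1 -scalerAr.
  by apply: submoduleD => //; apply: submoduleZ.
Qed.

Lemma Lambda_upto_stable m : (2 <= m <= n)%N ->
  gen_stable m (lspan (Lambda_upto m)).
Proof.
case: m => [|[|m]] //; elim: m => [|m IH] mn.
  rewrite Lambda_uptoS // [Lambda_upto 1]/= allpairs1l.
  rewrite (eq_map (@mul1r _)) map_id.
  exact: Lambda_two_stable.
by rewrite Lambda_uptoS //; apply: step_stable => //; apply: IH; lia.
Qed.

(** The span contains 1 and is stable under right multiplication by the generators, hence by every
    formal expression [u]. *)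
Lemma Lambda_span v : (2 <= n)%N -> lspan (Lambda e n) v.
Proof.
move=> n2; rewrite -/(Lambda_upto n).
have [|Bt Bs] := @Lambda_upto_stable n; first by rewrite n2 leqnn.
have BP := lspan_submodule (Lambda_upto n).
suff Bmul u x : lspan (Lambda_upto n) x ->
    lspan (Lambda_upto n) (x * presclass _ u).
  have [u ->] := presclass_surj v.
  by rewrite -[presclass _ u]mul1r; apply/Bmul/Lambda_upto_one.
elim: u x => [[i|j]|||u IH|u IHu w IHw|u IHu w IHw|k u IH] x Bx.
- have := Bt i _ Bx; rewrite (t_class _ (ltn_pmod i e_gt0)).
  congr (lspan _ (_ * presclass _ (EVar (GT n _)))).
  by apply: val_inj; rewrite /= modn_small.
- have jn := valP j; have := Bs (val j) _ jn Bx; rewrite (@s_class e n _ jn).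
  by congr (lspan _ (_ * presclass _ (EVar (GS e _)))); apply: val_inj.
- by rewrite presclass0 mulr0; case: BP.
- by rewrite presclass1 mulr1.
- by rewrite presclassN mulrN -scaleN1r; apply: submoduleZ => //; apply: IH.
- rewrite presclassD mulrDr.
  by apply: submoduleD => //; [apply: IHu | apply: IHw].
- by rewrite presclassM mulrA; apply/IHw/IHu.
- by rewrite presclassZ -scalerAr; apply: submoduleZ => //; apply: IH.
Qed.

Lemma gprod_cat l l' : gprod e n (l ++ l') = gprod e n l * gprod e n l'.
Proof. exact: big_cat. Qed.

Lemma gprod_gdown i j : gprod e n (gdown i j) = s_down e n i j.
Proof. by rewrite /gprod big_map. Qed.

Lemma gprod_gup i j : gprod e n (gup i j) = s_up e n i j.
Proof. by rewrite /gprod big_map. Qed.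

Lemma gprod_nwords_ i : (2 <= i)%N ->
  Lambda_ e n i = map (gprod e n) (nwords_ e i).
Proof.
move=> i2; have -> : map (gprod e n) (nwords_ e i) = Lambda_ge3 e n i.
  rewrite /nwords_ !map_cat /= -!map_comp map_allpairs /Lambda_ge3 /=.
  rewrite /gprod big_nil.
  congr (_ :: _ ++ _ ++ _).
  - by apply: eq_map => j; apply: gprod_gdown.
  - apply: eq_map => k /=.
    by rewrite -/(gprod _ _ _) gprod_cat gprod_gdown /gprod big_seq1.
  - apply: eq_allpairs => k j.
    by rewrite -/(gprod _ _ _) !gprod_cat gprod_gdown gprod_gup /gprod big_seq1.
rewrite /Lambda_; case: eqP => // ->.
rewrite /Lambda_two /Lambda_ge3 allpairs1r.
rewrite (@index_iota_nil 3 3) // cat0s.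
congr (_ ++ (_ ++ _)); apply: eq_map => k; rewrite s_down_nil // mul1r //.
by rewrite s_upS // s_up_nil // mul1r /sgen eqxx.
Qed.

Lemma Lambda_nwords :
  Lambda e n = map (gprod e n) (nwords e (index_iota 2 n.+1)).
Proof.
rewrite /Lambda /nwords.
have : all (leq 2) (index_iota 2 n.+1).
  by apply/allP => i; rewrite mem_index_iota => /andP[].
have : [:: 1] = map (gprod e n) [:: [::]] by rewrite /= /gprod big_nil.
elim: (index_iota _ _) [:: 1] [:: [::]] => [|i r IH] L L' -> // /andP[i2 r2].
apply: (IH _ _ _ r2); rewrite gprod_nwords_ // map_allpairs.
rewrite allpairs_mapl allpairs_mapr.
by apply: eq_allpairs => x y; rewrite gprod_cat.
Qed.

End Lambda.

Local Close Scope ring_scope.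

Theorem theorem5p1 (e n : nat) (he : (1 <= e)%N) (hn : (2 <= n)%N)
  (hen : ~ (n = 2 /\ ~~ odd e)) :
  is_basis (Lambda e n).
Proof.
split; last by move=> v; apply: Lambda_span.
have [|valid uniqW injW] := @nwords_inj e he n n; first by rewrite leqnn ltnW.
rewrite Lambda_nwords size_map => c c0.
apply: (@gprod_free e n) => //.
  apply/allP => l /valid; apply: sub_all => -[k|j] //= /andP[] //.
by rewrite -[RHS]c0; apply: eq_bigr => i _; rewrite (nth_map [::]).
Qed.
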